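(* Let $N\ge4$, and let $K_{2,N-2}$ be the complete bipartite graph with vertex groups $\{1,2\}$ and $\{3,\dots,N\}$, with $d_1=d_2=2$ and $d_3,\dots,d_N\ge2$ arbitrary. Then: (i) $(K_{2,N-2},d)$ has the interior point property; (ii) $(K_{2,N-2},d)$ has the positive margins property if and only if $N=4$; (iii) the global Markov ideal $I_{\mathrm{gl}(K_{2,N-2})}\subseteq\Bbbk[p_x:x\in\prod_v[d_v]]$ ($\Bbbk$ a field) is radical for all $N\ge4$.
   Context: Let $G$ be a finite simple undirected graph with vertex set $[N]=\{1,\dots,N\}$, $d=(d_v)_{v\in[N]}$ with integers $d_v\ge2$, $\mathcal X=\prod_v[d_v]$, and $x_W=(x_v)_{v\in W}$ for $W\subseteq[N]$. Global Markov moves and ideal: consider all partitions $[N]=A\cup B\cup C$ into disjoint (possibly empty) sets such that every path in $G$ from a vertex of $A$ to a vertex of $B$ meets $C$, and all states $x_A,x'_A,x_B,x'_B,x_C$ of the respective subsets. $I_{\mathrm{gl}(G)}\subseteq\Bbbk[p_x:x\in\mathcal X]$ is the ideal generated by all the binomials $p_{x_Ax_Bx_C}p_{x'_Ax'_Bx_C}-p_{x_Ax'_Bx_C}p_{x'_Ax_Bx_C}$. $\mathcal B_{\mathrm{gl}(G)}\subset\mathbb Z^{\mathcal X}$ is the set of all corresponding moves $e_{x_Ax_Bx_C}+e_{x'_Ax'_Bx_C}-e_{x_Ax'_Bx_C}-e_{x'_Ax_Bx_C}$ ($e_x$ = unit vectors). Margins: $A_G$ is the integer matrix with $(A_Gu)_{W,y}=\sum_{x\in\mathcal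 X:\,x_W=y}u_x$ for every clique $W$ of $G$ and every $y\in\prod_{v\in W}[d_v]$. The fiber of $u\in\mathbb N^{\mathcal X}$ is $\{v\in\mathbb N^{\mathcal X}:A_Gv=A_Gu\}$ ($0\in\mathbb N$). A fiber is connected by $\mathcal B_{\mathrm{gl}(G)}$ if any two of its elements are joined by a finite sequence in $\mathbb N^{\mathcal X}$ whose consecutive differences lie in $\pm\mathcal B_{\mathrm{gl}(G)}$. $(G,d)$ has the positive margins property if, for every $u\in\mathbb N^{\mathcal X}$ such that all entries of $A_Gu$ are strictly positive, the fiber of $u$ is connected by $\mathcal B_{\mathrm{gl}(G)}$. $(G,d)$ has the interior point property if, for every $u\in\mathbb N^{\mathcal X}$ such that $A_Gu$ lies in the relative interior of the cone $\mathbb R_{\ge0}A_G$ generated by the columns of $A_G$, the fiber of $u$ is connected by $\mathcal B_{\mathrm{gl}(G)}$. *)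

(* Defs.v *)
From HB Require Import structures.
From Stdlib Require Import Relation_Operators.
(* The notations of mpoly clash with those of mathcomp-analysis, and its names
   would shadow those of the files below if it came last. *)
From mathcomp Require Import (canonicals) mpoly.
From mathcomp Require Import all_boot all_order all_algebra.
From mathcomp Require Import classical_sets reals topology normedtype.

Set Implicit Arguments.
Unset Strict Implicit.
Unset Printing Implicit Defensive.

Import Order.TTheory GRing.Theory Num.Theory.
Import numFieldNormedType.Exports.

Local Open Scope classical_set_scope.
Local Open Scope ring_scope.

Section Convexity.
Variables (R : realType) (V : normedModType R).

Definition affine_hull (C : set V) : set V :=
  [set y | exists (n : nat) (a : 'I_n -> R) (z : 'I_n -> V),
     [/\ forall i, C (z i), \sum_i a i = 1 & y = \sum_i a i *: z i]].

(* The interior of [C] for the topology induced on its affine hull. *)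
Definition relative_interior (C : set V) : set V :=
  [set y | C y /\ within (affine_hull C) (nbhs y) C].

End Convexity.

Section Ideals.
Variable A : comNzRingType.

Definition ideal_generated (S : set A) : set A :=
  [set f | exists (n : nat) (c g : 'I_n -> A),
     (forall i, S (g i)) /\ f = \sum_i c i * g i].

Definition is_radical (I : set A) : Prop :=
  forall (f : A) (m : nat), I (f ^+ m) -> I f.

End Ideals.

(* The set [d_v] = {1, ..., d_v} is rendered by 'I_(d v) = {0, ..., d_v - 1}. *)
Definition state (V : finType) (d : V -> nat) : finType :=
  {dffun forall v : V, 'I_(d v)}.

Definition pstate (V : finType) (d : V -> nat) (W : {set V}) : finType :=
  {dffun forall v : {v : V | v \in W}, 'I_(d (val v))}.

Definition restrict (V : finType) (d : V -> nat) (W : {set V}) (x : state d) :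
    pstate d W :=
  [ffun v : {v : V | v \in W} => x (val v)].

Section Graph.
Variables (V : finType) (e : rel V).

Definition clique (W : {set V}) : bool :=
  [forall v in W, forall w in W, (v != w) ==> e v w].

Definition separates (C A B : {set V}) : Prop :=
  forall (a : V) (p : seq V),
    a \in A -> path e a p -> last a p \in B -> has (mem C) (a :: p).

Definition separating_partition (A B C : {set V}) : Prop :=
  [/\ (A :|: B :|: C)%SET = [set: V]%SET,
      [disjoint A & B]%B, [disjoint A & C]%B, [disjoint B & C]%B & separates C A B].

Variable d : V -> nat.

(* The state x_A x_B x_C.  The partial states x_A, x_B, x_C are given by full
   states xA, xB, xC, of which only the coordinates in A, B, C are used; every
   partial state arises in this way as soon as all d v are positive. *)
Definition glue (A B : {set V}) (xA xB xC : state d) : state d :=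
  [ffun v => if v \in A then xA v else if v \in B then xB v else xC v].

(* Vectors, matrices and polynomial variables are indexed by the states, and
   the rows of A_G by the pairs (W, y) with W a clique and y a state of W,
   through the enumerations of these finite types. *)
Definition unit_vec (x : state d) : 'cV[int]_#|state d| :=
  delta_mx (enum_rank x) 0.

Definition global_move (A B : {set V}) (xA xA' xB xB' xC : state d) :
    'cV[int]_#|state d| :=
  unit_vec (glue A B xA xB xC) + unit_vec (glue A B xA' xB' xC)
  - unit_vec (glue A B xA xB' xC) - unit_vec (glue A B xA' xB xC).

Definition global_moves : set 'cV[int]_#|state d| :=
  [set b | exists (A B C : {set V}) (xA xA' xB xB' xC : state d),
     separating_partition A B C /\ b = global_move A B xA xA' xB xB' xC].

Section Ideal.
Variable k : fieldType.

Definition pvar (x : state d) : mpoly.mpoly #|state d| k := mpoly.mpolyX k (mpoly.mnm1 (enum_rank x)).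

Definition global_binomial (A B : {set V}) (xA xA' xB xB' xC : state d) :
    mpoly.mpoly #|state d| k :=
  pvar (glue A B xA xB xC) * pvar (glue A B xA' xB' xC)
  - pvar (glue A B xA xB' xC) * pvar (glue A B xA' xB xC).

Definition global_ideal : set (mpoly.mpoly #|state d| k) :=
  ideal_generated
    [set f | exists (A B C : {set V}) (xA xA' xB xB' xC : state d),
       separating_partition A B C /\ f = global_binomial A B xA xA' xB xB' xC].

End Ideal.

Definition margin_index : finType :=
  {W : {W : {set V} | clique W} & pstate d (val W)}.

Definition margin_mx : 'M[int]_(#|margin_index|, #|state d|) :=
  \matrix_(i, j)
    (restrict (val (tag (enum_val i))) (enum_val j) == tagged (enum_val i))%:R.

Definition to_int (u : 'cV[nat]_#|state d|) : 'cV[int]_#|state d| :=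
  map_mx Posz u.

Definition margins (u : 'cV[nat]_#|state d|) : 'cV[int]_#|margin_index| :=
  margin_mx *m to_int u.

Definition fiber (u : 'cV[nat]_#|state d|) : set 'cV[nat]_#|state d| :=
  [set v | margins v = margins u].

Definition move_step (v w : 'cV[nat]_#|state d|) : Prop :=
  global_moves (to_int w - to_int v) \/ global_moves (- (to_int w - to_int v)).

Definition fiber_connected (u : 'cV[nat]_#|state d|) : Prop :=
  forall v w, fiber u v -> fiber u w -> clos_refl_trans _ move_step v w.

Definition positive_margins_property : Prop :=
  forall u : 'cV[nat]_#|state d|,
    (forall i, 0 < margins u i 0) -> fiber_connected u.

Definition marginal_cone (R : realType) : set 'cV[R]_#|margin_index| :=
  [set y | exists c : 'cV[R]_#|state d|,
     (forall j, 0 <= c j 0) /\ y = map_mx intr margin_mx *m c].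

Definition interior_point_property (R : realType) : Prop :=
  forall u : 'cV[nat]_#|state d|,
    relative_interior (@marginal_cone R) (map_mx intr (margins u)) ->
    fiber_connected u.

End Graph.

Arguments global_ideal {V} e d k.

(* The complete bipartite graph K_{2,N-2}: the vertices 1, ..., N are 0, ...,
   N - 1 in 'I_N, and the vertex groups are {0, 1} and {2, ..., N - 1}. *)
Definition complete_bipartite2 (N : nat) : rel 'I_N :=
  fun v w => (v < 2)%N != (w < 2)%N.

Arguments complete_bipartite2 N : clear implicits.

Lemma complete_bipartite2_sym (N : nat) : symmetric (complete_bipartite2 N).
Proof. by move=> v w; rewrite /complete_bipartite2 eq_sym. Qed.

Lemma complete_bipartite2_irrefl (N : nat) :
  irreflexive (complete_bipartite2 N).
Proof. by move=> v; rewrite /complete_bipartite2 eqxx. Qed.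

(* Main.v *)
From Stdlib Require Import Relation_Operators.
Require Import Defs.
From mathcomp Require Import (canonicals, coercions) mpoly.
From mathcomp Require Import classical_sets reals topology normedtype.
From mathcomp Require Import all_boot all_order all_algebra.
From mathcomp Require Import zify ring.

(** Write a state as its cell (the two hub coordinates) and its outer coordinates.
    The nontrivial global moves either swap outer coordinates inside a cell, or
    replace {00y, 11y} by {01y, 10y}. The former connect all multisets of states
    with the same counts, for each cell and outer vertex, of the values at this
    vertex. The latter shift the counts from one parity class of cells to the
    other, and apply as soon as some y is supported on both cells of a class. Two
    multisets with the same margins have, up to a sign depending on the parity,
    the same differences of counts at all cells; hence shifts connect them unless
    they have the same cell counts and no parity class admits a shift.

    A multiset admitting no shift lies on a proper face of the marginal cone,
    which gives (i). If moreover its margins are positive, its two obstructions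
    lie at distinct outer vertices and fix the counts there, which settles N = 4;
    a further vertex carries counts that the moves cannot change, whence (ii).
    For (iii), the monomials admitting a shift are separated modulo the ideal by
    the margins, and the others by the finer grading of all counts once the
    variables outside their support pattern are set to zero. These are morphisms
    to integral domains that kill the ideal. *)

Set Implicit Arguments.
Unset Strict Implicit.
Unset Printing Implicit Defensive.

Import Order.TTheory GRing.Theory Num.Theory.

(** * Sums over finite types and sublists *)

Lemma ltn_sum_at (I : finType) (P : pred I) (F G : I -> nat) i0 :
  P i0 -> (forall i, P i -> F i <= G i) -> F i0 < G i0 ->
  \sum_(i | P i) F i < \sum_(i | P i) G i.
Proof.
move=> Pi0 FG FG0; rewrite (bigD1 i0) // [X in _ < X](bigD1 i0) //=.
by apply: (leq_add FG0); apply: leq_sum => i /andP[/FG].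
Qed.

Lemma exists_ltn_sum (I : finType) (F G : I -> nat) :
  \sum_i F i < \sum_i G i -> exists i, F i < G i.
Proof.
move=> h; apply/existsP; apply: contraLR h; rewrite negb_exists -leqNgt.
by move/forallP => h; apply: leq_sum => i _; rewrite leqNgt.
Qed.

Lemma perm_rem2 (T : eqType) (x y : T) (s : seq T) :
  (forall z, count_mem z [:: x; y] <= count_mem z s) ->
  exists r, perm_eq s [:: x, y & r].
Proof.
move=> le_s; have xs : x \in s.
  by rewrite -has_pred1 has_count; apply: leq_trans (le_s x); rewrite /= eqxx.
have yr : y \in rem x s.
  rewrite -has_pred1 has_count; move: (le_s y).
  by rewrite (permP (perm_to_rem xs) (pred1 y)) /= eqxx; lia.
exists (rem y (rem x s)); apply: perm_trans (perm_to_rem xs) _.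
by rewrite perm_cons perm_to_rem.
Qed.

Lemma sum_eq_exists_ltn (I : finType) (F G : I -> nat) i0 :
  \sum_i F i = \sum_i G i -> F i0 != G i0 -> exists i, F i < G i.
Proof.
move=> FG; rewrite neq_ltn => /orP[|GF]; first by exists i0.
apply/existsP; apply: contraPT FG; rewrite negb_exists => /forallP h FG.
suff : \sum_i G i < \sum_i F i by rewrite FG ltnn.
by apply: (@ltn_sum_at _ _ _ _ i0) => // i _; rewrite leqNgt.
Qed.

(** * Vectors of multiplicities as multisets of states *)

Section States.
Variables (V : finType) (d : V -> nat).
Implicit Types (s t : seq (state d)) (u : 'cV[nat]_#|state d|).

Definition agree (W : {set V}) (x0 x : state d) : bool :=
  [forall v in W, x v == x0 v].

Lemma agreeP (W : {set V}) (x0 x : state d) :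
  reflect {in W, forall v, x v = x0 v} (agree W x0 x).
Proof. by apply: (iffP forall_inP) => h v /h /eqP. Qed.

Lemma agree_restrict (W : {set V}) (x0 x : state d) :
  (restrict W x == restrict W x0) = agree W x0 x.
Proof.
apply/eqP/agreeP => [h v Wv | h].
  by have /ffunP/(_ (Sub v Wv)) := h; rewrite !ffunE.
by apply/ffunP => v; rewrite !ffunE; apply: h; apply: valP.
Qed.

Lemma stateP (x y : state d) :
  (forall v, x v = y v :> nat) -> x = y.
Proof. by move=> h; apply/ffunP => v; apply/val_inj/h. Qed.

(** Vectors are handled as lists up to permutation, so that a move becomes the replacement of two
    entries. *)
Definition vecs s : 'cV[nat]_#|state d| :=
  (\col_i count_mem (enum_val i) s)%R.

Lemma vecsE s x : vecs s (enum_rank x) 0%R = count_mem x s.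
Proof. by rewrite mxE enum_rankK. Qed.

Lemma perm_vecs s t : perm_eq s t -> vecs s = vecs t.
Proof. by move/permP => h; apply/matrixP => i j; rewrite !mxE h. Qed.

Lemma vecs_perm s t : vecs s = vecs t -> perm_eq s t.
Proof.
move=> h; apply/allP => x _ /=.
by rewrite -!vecsE h eqxx.
Qed.

Lemma vecs_surj u : exists s, u = vecs s.
Proof.
exists (flatten [seq nseq (u i 0%R) (enum_val i) | i <- index_enum (ordinal #|state d|)]).
apply/matrixP => i j; rewrite ord1 mxE count_flatten sumnE !big_map.
rewrite (bigD1 i) //= count_nseq /= eqxx mul1n.
rewrite big1 ?addn0 // => k ki.
by rewrite count_nseq /= (can_eq enum_valK) (negbTE ki).
Qed.

End States.

(** * Margins and global moves of an arbitrary graph *)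

Section Margins.
Variables (V : finType) (e : rel V) (d : V -> nat).
Implicit Types (s t : seq (state d)).

Lemma margins_vecs s (i : 'I_#|margin_index e d|) :
  margins e (vecs s) i 0%R =
  Posz (count (fun x => restrict (val (tag (enum_val i))) x
                          == tagged (enum_val i)) s).
Proof.
rewrite mxE; under eq_bigr => j _ do rewrite !mxE.
elim: s => [|x s IH] /=.
  by apply: big1 => j _; rewrite mulr0.
rewrite PoszD -IH -[X in (X + _)%R]mulr1.
under eq_bigr => j _ do rewrite PoszD mulrDr.
rewrite big_split /=; congr (_ + _)%R.
rewrite (bigD1 (enum_rank x)) //= enum_rankK eqxx big1 ?addr0.
  by case: eqP.
move=> j jx; suff -> : (x == enum_val j) = false by rewrite mulr0.
by apply/eqP => xj; rewrite xj enum_valK eqxx in jx.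
Qed.

Definition same_margins s t : Prop :=
  forall (W : {set V}) x0, clique e W ->
    count (agree W x0) s = count (agree W x0) t.

Definition index_of (W : {set V}) (cW : clique e W) (x0 : state d) :
    margin_index e d :=
  Tagged (fun W => pstate d (val W)) (restrict (val (Sub W cW : {W | clique e W})) x0).

Lemma margins_index_of (W : {set V}) (cW : clique e W) x0 s :
  margins e (vecs s) (enum_rank (index_of cW x0)) 0%R = Posz (count (agree W x0) s).
Proof.
rewrite margins_vecs enum_rankK /=; congr Posz.
by apply: eq_count => x; rewrite agree_restrict.
Qed.

Lemma margin_indexP : (forall v, 0 < d v) -> forall i : margin_index e d,
  exists W (cW : clique e W) x0, i = index_of cW x0.
Proof.
move=> d_gt0 [[W cW] y]; exists W, cW.
pose f v := if insub v is Some w then val (y w) else 0.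
pose x0 : state d := [ffun v => insubd (Ordinal (d_gt0 v)) (f v)].
exists x0; congr existT; apply/ffunP => w; apply/val_inj.
by rewrite !ffunE val_insubd /f valK ltn_ord.
Qed.

Lemma same_marginsP (d_gt0 : forall v, 0 < d v) s t :
  margins e (vecs s) = margins e (vecs t) <-> same_margins s t.
Proof.
split=> [h W x0 cW | h].
  by have := margins_index_of cW x0 s; rewrite h margins_index_of => -[].
apply/matrixP => i j; rewrite ord1 -[i]enum_valK.
have [W [cW [x0 ->]]] := margin_indexP d_gt0 (enum_val i).
by rewrite !margins_index_of (h W x0 cW).
Qed.

(** An edge from A to B is a path avoiding C, so a clique cannot meet both. *)
Lemma clique_sep A B C W : separating_partition e A B C -> clique e W ->
  [disjoint W & A]%B \/ [disjoint W & B]%B.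
Proof.
case=> _ dAB dAC dBC sep /forall_inP cW.
have [?|/pred0Pn[a /andP[/= Wa Aa]]] := boolP [disjoint W & A]; first by left.
have [?|/pred0Pn[b /andP[/= Wb Bb]]] := boolP [disjoint W & B]; first by right.
have ab : a != b by apply: contraTneq Bb => <-; rewrite (disjointFr dAB Aa).
have eab : e a b by have /forall_inP/(_ b Wb)/implyP/(_ ab) := cW a Wa.
have := sep a [:: b] Aa; rewrite /= eab => /(_ isT Bb) /=.
by rewrite (disjointFr dAC Aa) (disjointFr dBC Bb).
Qed.

Inductive global_quad : state d -> state d -> state d -> state d -> Prop :=
  GlobalQuad A B C xA xA' xB xB' xC :
    separating_partition e A B C ->
    global_quad (glue A B xA xB xC) (glue A B xA' xB' xC)
                (glue A B xA xB' xC) (glue A B xA' xB xC).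

Lemma global_quad_sym x1 x2 x3 x4 :
  global_quad x1 x2 x3 x4 -> global_quad x3 x4 x1 x2.
Proof. by case=> *; econstructor; eauto. Qed.

(** The clique misses A or B, and changes there are invisible to it: [x1] matches [x4] in the first
    case and [x3] in the second. *)
Lemma quad_margins x1 x2 x3 x4 :
  global_quad x1 x2 x3 x4 -> same_margins [:: x1; x2] [:: x3; x4].
Proof.
case=> A B C xA xA' xB xB' xC sep W x0 cW /=.
have glueE (D : {set V}) (x y : state d) : [disjoint W & D]%B ->
    (forall v, v \notin D -> x v = y v) -> agree W x0 x = agree W x0 y.
  by move=> dWD h; apply/agreeP/agreeP => k v Wv; rewrite -k // h //
    (disjointFr dWD Wv).
have [dA|dB] := clique_sep sep cW.
  rewrite [in RHS]addnCA; congr (nat_of_bool _ + (nat_of_bool _ + _)); apply: (glueE A) => // v;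
    by rewrite !ffunE => /negbTE ->.
congr (nat_of_bool _ + (nat_of_bool _ + _)); apply: (glueE B) => // v;
  by rewrite !ffunE => /negbTE ->.
Qed.

Lemma quad_pointwise x1 x2 x3 x4 v : global_quad x1 x2 x3 x4 ->
  (x1 v = x3 v /\ x2 v = x4 v) \/ (x1 v = x4 v /\ x2 v = x3 v).
Proof.
by case=> A B C xA xA' xB xB' xC _; rewrite !ffunE; do !case: ifP; auto.
Qed.

(** Either the two states on A or those on B coincide, and the move is zero, or a vertex of A and
    one of B distinguish [x1] and [x2] from both [x3] and [x4]. *)
Lemma quad_trivial x1 x2 x3 x4 : global_quad x1 x2 x3 x4 ->
  (x1 == x3) || (x1 == x4) || (x2 == x3) || (x2 == x4) ->
  perm_eq [:: x1; x2] [:: x3; x4].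
Proof.
move=> q; suff: (x1 = x3 /\ x2 = x4) \/ (x1 = x4 /\ x2 = x3) \/
    [&& x1 != x3, x1 != x4, x2 != x3 & x2 != x4].
  case=> [[-> ->] | [[-> ->] |]] //; last by case/and4P; do 4!move/negbTE->.
  by move=> _; rewrite (perm_catC [:: x4] [:: x3]).
case: q => A B C xA xA' xB xB' xC [_ dAB _ _ _].
have [hA|/forall_inPn[a Aa ha]] := altP (@forall_inP V (mem A) (fun v => xA v == xA' v)).
  right; left; split; apply/ffunP => v; rewrite !ffunE; case: ifP => // Av;
  by have /eqP-> := hA v Av.
have [hB|/forall_inPn[b Bb hb]] := altP (@forall_inP V (mem B) (fun v => xB v == xB' v)).
  left; split; apply/ffunP => v; rewrite !ffunE; case: ifP => // Av; case: ifP => // Bv;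
  by have /eqP-> := hB v Bv.
have bA : b \in A = false by rewrite (disjointFl dAB Bb).
right; right; apply/and4P; split; apply/eqP => /ffunP h.
- by move: (h b) hb; rewrite !ffunE bA Bb => ->; rewrite eqxx.
- by move: (h a) ha; rewrite !ffunE Aa => ->; rewrite eqxx.
- by move: (h a) ha; rewrite !ffunE Aa => ->; rewrite eqxx.
- by move: (h b) hb; rewrite !ffunE bA Bb => ->; rewrite eqxx.
Qed.

(* The equivalences on multisets of states that contain the global moves and
   are compatible with sums; connectedness in fibers and congruence modulo the
   global Markov ideal are both of this kind. *)
Record move_congruence (E : seq (state d) -> seq (state d) -> Prop) : Prop := {
  mc_perm : forall s t, perm_eq s t -> E s t;
  mc_sym : forall s t, E s t -> E t s;
  mc_trans : forall s t r, E s t -> E t r -> E s r;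
  mc_cons : forall x s t, E s t -> E (x :: s) (x :: t);
  mc_quad : forall x1 x2 x3 x4, global_quad x1 x2 x3 x4 ->
    E [:: x1; x2] [:: x3; x4] }.

Lemma mc_catl E s t r : move_congruence E -> E s t -> E (r ++ s) (r ++ t).
Proof. by move=> mcE Est; elim: r => //= x r; apply: mc_cons. Qed.

Lemma mc_catr E s t r : move_congruence E -> E s t -> E (s ++ r) (t ++ r).
Proof.
move=> mcE Est; apply: (mc_trans mcE); first by apply: (mc_perm mcE); rewrite perm_catC.
apply: (mc_trans mcE) (mc_catl r mcE Est) _.
by apply: (mc_perm mcE); rewrite perm_catC.
Qed.

Lemma mc_quad_cat E x1 x2 x3 x4 r : move_congruence E ->
  global_quad x1 x2 x3 x4 -> E [:: x1, x2 & r] [:: x3, x4 & r].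
Proof. by move=> mcE /(mc_quad mcE)/(mc_catr r mcE). Qed.

Definition vec_connected s t : Prop :=
  clos_refl_trans _ (@move_step V e d) (vecs s) (vecs t).

Lemma move_step_sym (u v : 'cV[nat]_#|state d|) : move_step e u v -> move_step e v u.
Proof. by rewrite /move_step opprB => -[]; [right; rewrite opprB|left]. Qed.

Lemma vec_connected_congruence : move_congruence vec_connected.
Proof.
split=> [s t /perm_vecs st | s t | s t r | x s t | x1 x2 x3 x4 q].
- by rewrite /vec_connected st; apply: rt_refl.
- rewrite /vec_connected; elim=> [u v uv | u | u v w _ uv _ vw].
  + by apply: rt_step; apply: move_step_sym.
  + exact: rt_refl.
  + exact: rt_trans vw uv.
- exact: rt_trans.
(* Adding a copy of [x] leaves all differences unchanged, so paths can be translated. *)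
- pose f (u : 'cV[nat]_#|state d|) : 'cV[nat]_#|state d| :=
    (\col_i ((enum_val i == x) + u i 0%R)%N)%R.
  have fE r : vecs (x :: r) = f (vecs r).
    by apply/matrixP => i j; rewrite !mxE /= eq_sym.
  rewrite /vec_connected !fE; elim=> [u v uv | u | u v w _ uv _ vw].
  + suff fB : (to_int (f v) - to_int (f u) = to_int v - to_int u)%R.
      by apply: rt_step; rewrite /move_step fB.
    by apply/matrixP => i j; rewrite [j]ord1 !mxE !PoszD; lia.
  + exact: rt_refl.
  + exact: rt_trans uv vw.
- apply: rt_step; right; case: q => A B C xA xA' xB xB' xC sep.
  exists A, B, C, xA, xA', xB, xB', xC; split => //.
  apply/matrixP => i j; rewrite -[i]enum_valK [j]ord1 !mxE !enum_rankK /=.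
  rewrite !(can_eq enum_rankK) !eqxx !andbT !addn0 !PoszD.
  by rewrite ![_ == enum_val i]eq_sym !natz; ring.
Qed.

(** A difference of vectors shows a move only up to cancellation. If terms cancel, [quad_trivial]
    makes the move zero; otherwise both removed states must occur in [u], with multiplicity. *)
Lemma move_step_quad (u v : 'cV[nat]_#|state d|) : move_step e u v -> u = v \/
  exists x1 x2 x3 x4 r, [/\ global_quad x1 x2 x3 x4,
    u = vecs [:: x3, x4 & r] & v = vecs [:: x1, x2 & r]].
Proof.
move=> h; have {h} [x1 [x2 [x3 [x4 [q hq]]]]] : exists x1 x2 x3 x4,
  global_quad x1 x2 x3 x4 /\ (to_int v - to_int u =
    unit_vec x1 + unit_vec x2 - unit_vec x3 - unit_vec x4)%R.
  case: h => -[A [B [C [xA [xA' [xB [xB' [xC [sep h]]]]]]]]]; do 4!eexists.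
    by split; [exact: (GlobalQuad xA xA' xB xB' xC sep) | exact: h].
  split; first exact: global_quad_sym (GlobalQuad xA xA' xB xB' xC sep).
  by apply: oppr_inj; rewrite h /global_move !opprD !opprK -[RHS]addrA [RHS]addrC addrA.
have [s us] := vecs_surj u; have [t vt] := vecs_surj v; subst u v.
have {}hq x : count_mem x t + count_mem x [:: x3; x4] =
    count_mem x s + count_mem x [:: x1; x2].
  have := congr1 (fun M : 'cV_ _ => M (enum_rank x) 0%R) hq.
  rewrite !mxE !enum_rankK !(can_eq enum_rankK) !eqxx !andbT /= !natz.
  rewrite ![x == _]eq_sym; lia.
have [p|] := boolP ((x1 == x3) || (x1 == x4) || (x2 == x3) || (x2 == x4)).
  left; apply/perm_vecs; apply/allP => x _ /=.
  have /permP/(_ (pred1 x)) := quad_trivial q p; move: (hq x) => /=; lia.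
rewrite !negb_or -!andbA => /and4P[n13 n14 n23 n24]; right.
have [|r sr] := @perm_rem2 _ x3 x4 s.
  move=> z; move: (hq z) => /=.
  have [z3|] := eqVneq x3 z; first by subst z; rewrite (negbTE n13) (negbTE n23); lia.
  have [z4|] := eqVneq x4 z; last lia.
  by subst z; rewrite (negbTE n14) (negbTE n24); lia.
exists x1, x2, x3, x4, r; split => //; first exact: perm_vecs.
apply/perm_vecs/allP => x _ /=; move: (hq x) (permP sr (pred1 x)) => /=; lia.
Qed.

End Margins.

(** * Linear functionals of the margins *)

Section MarginFunctions.
Local Open Scope ring_scope.
Variables (V : finType) (e : rel V) (d : V -> nat) (R : comNzRingType).

(** The row space of [margin_mx] over [R], read as functions on the states. *)
Definition margin_function (f : state d -> R) : Prop :=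
  exists l : 'rV[R]_#|margin_index e d|, forall x,
    f x = (l *m map_mx intr (margin_mx e d)) 0 (enum_rank x).

Lemma margin_functionD f g : margin_function f -> margin_function g ->
  margin_function (fun x => f x + g x).
Proof.
by move=> [k hk] [l hl]; exists (k + l) => x; rewrite mulmxDl mxE hk hl.
Qed.

Lemma margin_functionB f g : margin_function f -> margin_function g ->
  margin_function (fun x => f x - g x).
Proof.
by move=> [k hk] [l hl]; exists (k - l) => x; rewrite mulmxBl !mxE hk hl !mxE.
Qed.

Lemma margin_function_sum (I : finType) (P : pred I) (f : I -> state d -> R) :
  (forall i, P i -> margin_function (f i)) ->
  margin_function (fun x => \sum_(i | P i) f i x).
Proof.
move=> hf; have [|l hl] := @fin_all_exists _ _ (fun i (l : 'rV[R]_#|margin_index e d|) =>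
    P i -> forall x, f i x = (l *m map_mx intr (margin_mx e d)) 0 (enum_rank x)).
  by move=> i; case Pi: (P i); [have [l] := hf i Pi; exists l | exists 0].
exists (\sum_(i | P i) l i) => x; rewrite mulmx_suml summxE.
by apply: eq_bigr => i Pi; apply: hl.
Qed.

Lemma margin_function_agree W x0 : clique e W ->
  margin_function (fun x => (agree W x0 x)%:R).
Proof.
move=> cW; exists (delta_mx 0 (enum_rank (index_of cW x0))) => x.
rewrite -rowE !mxE !enum_rankK /= agree_restrict.
by case: agree.
Qed.

Lemma eq_margin_function f g : f =1 g -> margin_function f -> margin_function g.
Proof. by move=> fg [l hl]; exists l => x; rewrite -fg. Qed.

End MarginFunctions.

(** * Radicality of binomial ideals *)

Section BinomialRadical.
Local Open Scope ring_scope.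
Local Notation mpoly := mpoly.mpoly.
Local Notation multinom := mpoly.multinom.
Local Notation mcoeff := mpoly.mcoeff.
Local Notation msupp := mpoly.msupp.
Variables (k : fieldType) (n : nat) (I : mpoly.mpoly n k -> Prop).
Local Notation X := (mpoly.mpolyX k).

(** A monomial map to a polynomial ring, hence to an integral domain, that kills the variables
    outside [S]. *)
Definition graded_morphism m (S : pred 'I_n) (M : 'I_n -> multinom m) :
    mpoly n k -> mpoly m k :=
  mpoly.mmap (@mpoly.mpolyC m k) (fun i => if S i then mpoly.mpolyX k (M i) else 0).

Definition weight m (M : 'I_n -> multinom m) (u : multinom n) : multinom m :=
  \big[@mpoly.mnm_add m/mpoly.mnm0]_i mpoly.mnm_muln (M i) (u i).

Lemma graded_morphismX m S (M : 'I_n -> multinom m) (u : multinom n) :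
  graded_morphism S M (X u) =
  if [forall i, (u i != 0%N) ==> S i] then X (weight M u) else 0.
Proof.
rewrite /graded_morphism mpoly.mmapX /mpoly.mmap1; case: ifP => [/forallP h|/forallPn[i]].
  rewrite /weight -mpoly.mprodXnE; apply: eq_bigr => i _.
  by have := h i; case: (u i) => [|a] /=; rewrite ?expr0 // => ->.
by rewrite negb_imply => /andP[ui /negbTE Si]; rewrite (bigD1 i) //= Si expr0n (negbTE ui) mul0r.
Qed.

Lemma graded_morphismZ m S (M : 'I_n -> multinom m) c f :
  graded_morphism S M (c *: f) = mpoly.mpolyC m c * graded_morphism S M f.
Proof. exact: mpoly.mmapZ. Qed.

Lemma graded_morphism_sum m S (M : 'I_n -> multinom m) (J : Type) (r : seq J) (P : pred J) F :
  graded_morphism S M (\sum_(i <- r | P i) F i) = \sum_(i <- r | P i) graded_morphism S M (F i).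
Proof. exact: raddf_sum. Qed.

Lemma graded_morphismB m S (M : 'I_n -> multinom m) f g :
  graded_morphism S M (f - g) = graded_morphism S M f - graded_morphism S M g.
Proof. exact: raddfB. Qed.

Lemma graded_morphismM m S (M : 'I_n -> multinom m) f g :
  graded_morphism S M (f * g) = graded_morphism S M f * graded_morphism S M g.
Proof. exact: rmorphM. Qed.

Lemma graded_morphismXn m S (M : 'I_n -> multinom m) f i :
  graded_morphism S M (f ^+ i) = graded_morphism S M f ^+ i.
Proof. exact: rmorphXn. Qed.

Hypothesis I0 : I 0.
Hypothesis ID : forall f g, I f -> I g -> I (f + g).
Hypothesis IM : forall c f : mpoly n k, I f -> I (c * f).

Definition graded_zero (f : mpoly n k) : Prop :=
  forall m S (M : 'I_n -> multinom m),
    (forall g, I g -> graded_morphism S M g = 0) -> graded_morphism S M f = 0.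

(** The map attached to [u] kills the ideal but not the monomial of [u], and surviving monomials
    with the same image are congruent to it. *)
Hypothesis separated : forall u : multinom n,
  exists m S (M : 'I_n -> multinom m),
    [/\ forall g, I g -> graded_morphism S M g = 0,
        forall i, u i != 0%N -> S i &
        forall v : multinom n, (forall i, v i != 0%N -> S i) -> weight M u = weight M v ->
          I (X (u) - X (v))].

(** Induction on the number of terms, cancelling one term at a time by a binomial of [I]. *)
Lemma graded_zero_ideal f : graded_zero f -> I f.
Proof.
have [b] := ubnP (size (msupp f)); elim: b f => // b IH f; rewrite ltnS => fb fZ.
have [f0|/eqP f0] := eqVneq (msupp f) [::]; first by rewrite (mpoly.msuppnil0 f0).
case fE : (msupp f) f0 => [//|u r] _.
have uf : u \in msupp f by rewrite fE mem_head.
have [m [S [M [kill Su sep]]]] := separated u.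
(* Were [u] the only surviving term of its weight, the image of [f] would have the nonzero
   coefficient of [u] there. *)
have [v [vf vu Sv wv]] : exists v : multinom n, [/\ v \in msupp f, v != u,
    forall i, v i != 0%N -> S i & weight M u = weight M v].
  have [/hasP[v vf /and3P[vu /forallP Sv /eqP wv]]|/hasPn nov] := boolP (has
      (fun v : multinom n => [&& v != u, [forall i, (v i != 0%N) ==> S i]
         & weight M u == weight M v]) (msupp f)).
    by exists v; split => // i; apply/implyP.
  have := fZ m S M kill; rewrite [X in graded_morphism _ _ X]mpoly.mpolyE.
  rewrite graded_morphism_sum.
  move/(congr1 (mcoeff (weight M u))); rewrite mpoly.mcoeff0 raddf_sum /=.
  rewrite (bigD1_seq u) ?mpoly.msupp_uniq //= graded_morphismZ graded_morphismX.
  rewrite ifT; last by apply/forallP => i; apply/implyP/Su.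
  rewrite mpoly.mcoeffCM mpoly.mcoeffX eqxx mulr1 big_seq_cond big1 ?addr0.
    by move/eqP; rewrite mpoly.mcoeff_eq0 uf.
  move=> v /andP[vf vu]; rewrite graded_morphismZ graded_morphismX.
  have := nov v vf; rewrite vu /= mpoly.mcoeffCM; case: ifP => _ /=.
    by rewrite mpoly.mcoeffX eq_sym => /negbTE->; rewrite mulr0.
  by rewrite mpoly.mcoeff0 mulr0.
(* Subtracting this element removes [u] and creates no new monomial, since [v] already occurs in
   [f]. *)
have Iuv : I (mpoly.mpolyC n (mcoeff u f) * (X (u) - X (v))) by apply/IM/sep.
rewrite -[f](subrK (mpoly.mpolyC n (mcoeff u f) * (X (u) - X (v)))); apply: ID => //.
apply: IH.
  apply: leq_trans fb; rewrite fE /= ltnS.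
  apply: uniq_leq_size (mpoly.msupp_uniq _) _ => w.
  rewrite mpoly.mcoeff_msupp mpoly.mcoeffB mpoly.mcoeffCM mpoly.mcoeffB !mpoly.mcoeffX => nz.
  have wu : w != u.
    apply: contraNneq nz => ->; rewrite eqxx (negbTE vu) subr0 mulr1.
    exact/eqP/subrr.
  have : w \in msupp f.
    rewrite mpoly.mcoeff_msupp; apply: contraNneq nz => f0.
    rewrite f0 [u == w]eq_sym (negbTE wu); case: (v =P w) => [vw|_].
      by move: vf; rewrite vw mpoly.mcoeff_msupp f0 eqxx.
    have E (a : k) : 0 - a * (0 - 0) = 0 by rewrite subr0 mulr0 subr0.
    exact/eqP/E.
  by rewrite fE inE (negbTE wu).
by move=> m' S' M' kill'; rewrite graded_morphismB fZ // kill' // subrr.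
Qed.

(** The maps take values in integral domains, so they kill [f] along with its power. *)
Lemma binomial_radical f m : I (f ^+ m) -> I f.
Proof.
move=> If; apply: graded_zero_ideal => m' S M kill.
have := kill _ If; rewrite graded_morphismXn => /eqP.
by rewrite expf_eq0 => /andP[_ /eqP].
Qed.

End BinomialRadical.

(** * The global Markov ideal of an arbitrary graph *)

Section GlobalIdeal.
Local Open Scope ring_scope.
Variables (V : finType) (e : rel V) (d : V -> nat) (k : fieldType).
Local Notation I := (global_ideal e d k).
Local Notation X := (mpoly.mpolyX k).
Local Notation mpoly := (mpoly.mpoly #|state d| k).
Local Notation monomial s := (\prod_(x <- s) pvar k x : mpoly).

Lemma global_ideal0 : I 0.
Proof.
by exists 0, (fun=> 0), (fun=> 0); split; [case | rewrite big_ord0].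
Qed.

Lemma global_idealD f g : I f -> I g -> I (f + g).
Proof.
case=> n1 [c1 [g1 [h1 ->]]] [n2 [c2 [g2 [h2 ->]]]].
exists (n1 + n2), (fun i => match split i with inl j => c1 j | inr j => c2 j end),
  (fun i => match split i with inl j => g1 j | inr j => g2 j end); split.
  by move=> i; case: (split i).
rewrite big_split_ord; congr (_ + _); apply: eq_bigr => i _.
  by rewrite (unsplitK (inl i)).
by rewrite (unsplitK (inr i)).
Qed.

Lemma global_idealM c f : I f -> I (c * f).
Proof.
case=> n [a [g [h ->]]]; exists n, (fun i => c * a i), g; split=> //.
by rewrite mulr_sumr; apply: eq_bigr => i _; rewrite mulrA.
Qed.

Lemma global_ideal_congruence :
  move_congruence e (fun s t => I (monomial s - monomial t)).
Proof.
split=> [s t st | s t h | s t r h h' | x s t h | x1 x2 x3 x4 q].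
- by rewrite (perm_big _ st) subrr; exact: global_ideal0.
- by rewrite -opprB -mulN1r; exact: global_idealM.
- by rewrite -(subrK (monomial t) (monomial s)) -addrA; exact: global_idealD.
- by rewrite !big_cons -mulrBr; exact: global_idealM.
- rewrite !big_cons !big_nil !mulr1; exists 1, (fun=> 1),
    (fun=> pvar k x1 * pvar k x2 - pvar k x3 * pvar k x4).
  split; last by rewrite big_ord1 mul1r.
  by move=> _; case: q => A B C xA xA' xB xB' xC sep;
    exists A, B, C, xA, xA', xB, xB', xC.
Qed.

Definition exponent (s : seq (state d)) : mpoly.multinom #|state d| :=
  \big[@mpoly.mnm_add _/mpoly.mnm0]_(x <- s) mpoly.mnm1 (enum_rank x).

Lemma exponentE s i : exponent s i = count_mem (enum_val i) s.
Proof.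
rewrite mpoly.mnm_sumE -sum1_count [RHS]big_mkcond; apply: eq_bigr => x _.
by rewrite mpoly.mnm1E /= -(can_eq enum_valK) enum_rankK; case: eqP.
Qed.

Lemma monomialE s : monomial s = X (exponent s).
Proof.
elim: s => [|x s IH]; first by rewrite /exponent !big_nil mpoly.mpolyX0.
by rewrite /exponent !big_cons mpoly.mpolyXD -IH.
Qed.

Lemma exponent_surj u : exists s, u = exponent s.
Proof.
have [s us] := vecs_surj (\col_i u i); exists s; apply/mpoly.mnmP => i.
rewrite exponentE; have := congr1 (fun M : 'cV_ _ => M i 0) us.
by rewrite !mxE.
Qed.

Lemma sum_enum_val (F : state d -> nat) s :
  (\sum_(i < #|state d|) F (enum_val i) * count_mem (enum_val i) s = \sum_(x <- s) F x)%N.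
Proof.
elim: s => [|x s IH]; first by rewrite big_nil big1 // => i _; rewrite muln0.
rewrite big_cons -IH; under eq_bigr => i _ do rewrite /= mulnDr.
rewrite big_split /=; congr addn.
rewrite (bigD1 (enum_rank x)) //= enum_rankK eqxx muln1 big1 ?addn0 // => i ix.
suff -> : (x == enum_val i) = false by rewrite muln0.
by apply/eqP => xi; rewrite xi enum_valK eqxx in ix.
Qed.

(** A monomial map kills the ideal once the two products in each generator are both killed or both
    survive with the same weight. *)
Lemma global_ideal_radical :
  (forall s : seq (state d), exists (T : finType) (S : pred (state d))
      (w : state d -> T -> nat),
    [/\ all S s,
        forall x1 x2 x3 x4, global_quad e x1 x2 x3 x4 ->
          S x1 && S x2 = S x3 && S x4 /\
          (S x1 && S x2 -> forall r, w x1 r + w x2 r = w x3 r + w x4 r)%N &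
        forall t, all S t ->
          (forall r, \sum_(x <- s) w x r = \sum_(x <- t) w x r)%N ->
          I (monomial s - monomial t)]) ->
  is_radical I.
Proof.
move=> sep f m; apply: binomial_radical => {f m}.
- exact: global_ideal0.
- exact: global_idealD.
- exact: global_idealM.
move=> u; have [s ->] := exponent_surj u.
have [T [S [w [Ss quad st]]]] := sep s.
pose M (i : 'I_#|state d|) : mpoly.multinom #|T| :=
  mpoly.Multinom (mktuple (fun r => w (enum_val i) (enum_val r))).
have ME i r : M i r = w (enum_val i) (enum_val r) by rewrite mpoly.mnmE.
have SE t : (forall i, exponent t i != 0%N -> S (enum_val i)) <-> all S t.
  split=> [h|/allP h i].
    apply/allP => x xt; rewrite -(enum_rankK x); apply: h.
    by rewrite exponentE enum_rankK -lt0n -has_count has_pred1.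
  by rewrite exponentE -lt0n -has_count has_pred1; exact: h.
exists #|T|, (fun i => S (enum_val i)), M; split.
- have gX x : graded_morphism (fun i => S (enum_val i)) M (pvar k x) =
      if S x then X (M (enum_rank x)) else 0.
    by rewrite /graded_morphism mpoly.mmapX mpoly.mmap1U enum_rankK.
  have gXX x y : graded_morphism (fun i => S (enum_val i)) M (pvar k x * pvar k y) =
      if S x && S y then X (mpoly.mnm_add (M (enum_rank x)) (M (enum_rank y))) else 0.
    rewrite graded_morphismM !gX mpoly.mpolyXD.
    by case: (S x); case: (S y); rewrite ?mul0r ?mulr0.
  move=> g [n [c [b [hb ->]]]]; rewrite graded_morphism_sum big1 // => i _.
  rewrite graded_morphismM; have [A [B [C [xA [xA' [xB [xB' [xC [sp ->]]]]]]]]] := hb i.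
  rewrite graded_morphismB !gXX.
  have [<- hw] := quad _ _ _ _ (GlobalQuad xA xA' xB xB' xC sp).
  case: ifP => [/hw {}hw|]; last by rewrite subrr mulr0.
  rewrite (_ : mpoly.mnm_add _ _ = mpoly.mnm_add (M (enum_rank (glue A B xA xB' xC)))
    (M (enum_rank (glue A B xA' xB xC)))) ?subrr ?mulr0 //.
  by apply/mpoly.mnmP => r; rewrite !mpoly.mnmDE !ME !enum_rankK.
- exact/SE.
- move=> v; have [t ->] := exponent_surj v => /SE St wst.
  rewrite -!monomialE; apply: st => // r.
  have wE t' : weight M (exponent t') (enum_rank r) = (\sum_(x <- t') w x r)%N.
    rewrite mpoly.mnm_sumE -sum_enum_val; apply: eq_bigr => i _.
    by rewrite mpoly.mulmnE ME exponentE enum_rankK.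
  by rewrite -!wE wst.
Qed.

End GlobalIdeal.

(** * Cells, counts and basic moves of the bipartite graph *)

Section Bipartite.
Variables (N : nat) (d : 'I_N -> nat).
Hypotheses (hN : 4 <= N) (hd : forall v : 'I_N, 2 <= d v).
Hypothesis hd2 : forall v : 'I_N, v < 2 -> d v = 2.

Local Notation e := (complete_bipartite2 N).
Local Notation outer j := (2 <= nat_of_ord j).
Local Notation st := (state d).
Implicit Types (s t r : seq st) (y : st) (c : bool * bool) (j : 'I_N).

Definition v0 : 'I_N := Ordinal (leq_trans (isT : 0 < 4) hN).
Definition v1 : 'I_N := Ordinal (leq_trans (isT : 1 < 4) hN).
Definition v2 : 'I_N := Ordinal (leq_trans (isT : 2 < 4) hN).

Lemma d_gt0 v : 0 < d v. Proof. exact: ltnW. Qed.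

Variant vertex_spec (v : 'I_N) : Prop :=
  | VertexZero of v = v0 | VertexOne of v = v1 | VertexOuter of outer v.

Lemma vertexP v : vertex_spec v.
Proof.
case: v => -[|[|n]] nN; [constructor 1|constructor 2|constructor 3] => //; exact: val_inj.
Qed.

Lemma outer_neq j : outer j -> (j == v0 = false) * (j == v1 = false).
Proof. by move=> oj; split; apply/eqP => jE; move: oj; rewrite jE. Qed.

(** Values out of range are replaced by 0. *)
Definition mkstate (f : 'I_N -> nat) : st :=
  [ffun v => insubd (Ordinal (d_gt0 v)) (f v)].

Lemma mkstateE f v : f v < d v -> mkstate f v = f v :> nat.
Proof. by move=> fv; rewrite ffunE val_insubd fv. Qed.

Definition cell (x : st) : bool * bool := (0 < x v0, 0 < x v1).

Lemma coord0 (x : st) : x v0 = (cell x).1 :> nat.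
Proof.
have : x v0 < 2 by apply: leq_trans (ltn_ord _) _; rewrite hd2.
by rewrite /=; case: (x v0 : nat) => [|[]].
Qed.

Lemma coord1 (x : st) : x v1 = (cell x).2 :> nat.
Proof.
have : x v1 < 2 by apply: leq_trans (ltn_ord _) _; rewrite hd2.
by rewrite /=; case: (x v1 : nat) => [|[]].
Qed.

Lemma state_eq (x y : st) : cell x = cell y ->
  (forall j, outer j -> x j = y j :> nat) -> x = y.
Proof.
move=> cxy h; apply: stateP => v; case: (vertexP v) => [->|->|/h //].
  by rewrite !coord0 cxy.
by rewrite !coord1 cxy.
Qed.

Definition setcell c (y : st) : st :=
  mkstate (fun v => if v == v0 then c.1 : nat else if v == v1 then c.2 : nat
                    else y v).

Lemma cell_setcell c y : cell (setcell c y) = c.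
Proof.
case: c => p q; rewrite /cell /setcell; congr (_, _); rewrite mkstateE /= ?eqxx;
  by [case: p q => -[] | rewrite hd2; case: p q => -[]].
Qed.

Lemma setcell_outer c y j : outer j -> setcell c y j = y j :> nat.
Proof. by move=> oj; rewrite mkstateE !outer_neq // ltn_ord. Qed.

Definition setcoord j0 (a : nat) (y : st) : st :=
  mkstate (fun v => if v == j0 then a else y v).

Lemma setcoordE j0 a y j : a < d j0 ->
  setcoord j0 a y j = (if j == j0 then a else y j) :> nat.
Proof. by move=> ad; rewrite mkstateE; case: eqP => // ->. Qed.

Definition opp c : bool * bool := (~~ c.1, ~~ c.2).
Definition par c : bool := c.1 (+) c.2.
Definition flip c : bool * bool := (c.1, ~~ c.2).

Definition cnt j c (a : nat) s : nat :=
  count (fun x : st => (cell x == c) && (x j == a :> nat)) s.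
Definition ncell c s : nat := count (fun x => cell x == c) s.
Definition same_cnt s t : Prop :=
  forall j c a, outer j -> cnt j c a s = cnt j c a t.

Lemma cnt_large j c a s : d j <= a -> cnt j c a s = 0.
Proof.
move=> da; rewrite /cnt (@eq_count _ _ pred0) ?count_pred0 // => x /=.
by have := ltn_ord (x j); case: (x j =P a :> nat) => [->|]; rewrite ?andbF //; lia.
Qed.

Lemma sum_cnt j c s : \sum_(a < d j) cnt j c a s = ncell c s.
Proof.
rewrite /ncell; elim: s => [|x s IH] /=; first by rewrite big1.
rewrite big_split /= -/(cnt j c _ s); congr (_ + _) => //.
rewrite (bigD1 (x j)) //= eqxx andbT big1 ?addn0 // => a.
by rewrite eq_sym -val_eqE => /negbTE /= ->; rewrite andbF.
Qed.

Lemma cnt_cons j c a x s :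
  cnt j c a (x :: s) = (cell x == c) && (x j == a :> nat) + cnt j c a s.
Proof. by []. Qed.

Lemma perm_same_cnt s t : perm_eq s t -> same_cnt s t.
Proof. by move=> /permP h j c a _; apply: h. Qed.

Lemma clique_spoke (h j : 'I_N) : h < 2 -> outer j -> clique e [set h; j].
Proof.
move=> h2 oj; have nj : (j < 2) = false by rewrite ltnNge oj.
apply/forall_inP => v; rewrite !inE => /orP[]/eqP->;
  apply/forall_inP => w; rewrite !inE => /orP[]/eqP->; apply/implyP => //;
  by rewrite ?eqxx // /complete_bipartite2 h2 nj.
Qed.

Lemma agree_spoke (h j : 'I_N) (x0 x : st) :
  agree [set h; j] x0 x = (x h == x0 h :> nat) && (x j == x0 j :> nat).
Proof.
apply/agreeP/andP => [k | [/eqP hh /eqP hj] v].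
  by rewrite !k ?inE ?eqxx ?orbT.
by rewrite !inE => /orP[]/eqP->; apply/val_inj.
Qed.

Definition spoke j c (a : nat) : st := setcoord j a (setcell c (mkstate (fun=> 0))).

(** The margin on a hub and [j] sums over the other hub, hence over two adjacent cells. *)
Lemma count_spoke j c a s : outer j -> a < d j ->
  count (agree [set v0; j] (spoke j c a)) s = cnt j c a s + cnt j (c.1, ~~ c.2) a s /\
  count (agree [set v1; j] (spoke j c a)) s = cnt j c a s + cnt j (~~ c.1, c.2) a s.
Proof.
move=> oj ad.
have x0j : spoke j c a j = a :> nat by rewrite setcoordE ?eqxx.
have x0h (g : 'I_N) : g < 2 -> spoke j c a g = setcell c (mkstate (fun=> 0)) g :> nat.
  by move=> g2; rewrite setcoordE //; case: eqP => // gj; move: g2; rewrite gj; lia.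
have sumE (P Q : pred st) r : (forall x, ~~ (P x && Q x)) ->
    count P r + count Q r = count (predU P Q) r.
  by move=> PQ; rewrite -count_predUI (@eq_count _ (predI P Q) pred0)
    ?count_pred0 ?addn0 // => x /=; exact/negbTE.
split; rewrite sumE; try by move=> x; case: (cell x) c {x0j x0h} => -[] [] [[] []];
  rewrite /= ?andbF.
  apply: eq_count => x /=; rewrite agree_spoke x0j x0h // !coord0 cell_setcell.
  by rewrite -andb_orl; congr (_ && _); case: (cell x) c {x0j x0h} => -[] [] [[] []].
apply: eq_count => x /=; rewrite agree_spoke x0j x0h // !coord1 cell_setcell.
by rewrite -andb_orl; congr (_ && _); case: (cell x) c {x0j x0h} => -[] [] [[] []].
Qed.

Lemma margin_cnt j c a s t : outer j -> same_margins e s t ->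
  cnt j c a s + cnt j (c.1, ~~ c.2) a s = cnt j c a t + cnt j (c.1, ~~ c.2) a t /\
  cnt j c a s + cnt j (~~ c.1, c.2) a s = cnt j c a t + cnt j (~~ c.1, c.2) a t.
Proof.
move=> oj h; have [ad|?] := ltnP a (d j); last by rewrite !cnt_large.
have [<- <-] := count_spoke c s oj ad; have [<- <-] := count_spoke c t oj ad.
by split; apply/h/clique_spoke.
Qed.

(** The margins fix the sums of counts over adjacent cells; around the square of cells, the
    difference between [s] and [t] therefore alternates in sign. *)
Lemma cnt_diff j c c' a s t : outer j -> same_margins e s t ->
  if par c == par c' then cnt j c a s + cnt j c' a t = cnt j c a t + cnt j c' a s
  else cnt j c a s + cnt j c' a s = cnt j c a t + cnt j c' a t.
Proof.
move=> oj h; have := margin_cnt (true, true) a oj h; have := margin_cnt (false, false) a oj h.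
by case: c c' => -[] [] [[] []] /=; lia.
Qed.

(** The hubs separate [j] from the other outer vertices, and two states in one cell agree on this
    separator. *)
Lemma swap_quad (y z : st) j : outer j -> cell y = cell z ->
  exists y' z', [/\ global_quad e y z y' z',
    cell y' = cell y, cell z' = cell y &
    forall i, outer i ->
      y' i = (if i == j then z i else y i) /\ z' i = (if i == j then y i else z i)].
Proof.
move=> oj cyz.
pose A := [set j]; pose B := [set i | outer i && (i != j)].
pose C := [set i : 'I_N | i < 2].
have sep : separating_partition e B A C.
  split.
  - by apply/setP => i; rewrite !inE; case: eqP => [->|_] /=; rewrite ?oj ?orbT //; case: leqP.
  - by rewrite disjoints_subset; apply/subsetP => i; rewrite !inE => /andP[].
  - by rewrite disjoints_subset; apply/subsetP => i; rewrite !inE; lia.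
  - by rewrite disjoints_subset; apply/subsetP => i; rewrite !inE => /eqP->; lia.
  - move=> a [|b p]; rewrite !inE => /andP[oa aj]; first by rewrite /= inE (negbTE aj).
    move=> /= /andP[eab _] _; apply/orP; right; apply/orP; left.
    by rewrite inE; move: eab oa; rewrite /complete_bipartite2; lia.
have gy : glue B A y y y = y by apply/ffunP => i; rewrite !ffunE; do !case: ifP.
have gz : glue B A z z y = z.
  apply: stateP => i; rewrite ffunE !inE.
  case: (vertexP i) => [->|->|oi]; last by rewrite oi /=; case: eqP.
    by rewrite eq_sym outer_neq //= !coord0 cyz.
  by rewrite eq_sym outer_neq //= !coord1 cyz.
have q := GlobalQuad y z y z y sep; rewrite gy gz in q.
exists (glue B A y z y), (glue B A z y y); split => //.
- by rewrite /cell !ffunE !inE ![_ == j]eq_sym !outer_neq.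
- by rewrite /cell !ffunE !inE ![_ == j]eq_sym !outer_neq.
- by move=> i oi; rewrite !ffunE !inE oi /=; case: eqP.
Qed.

(** The hubs are not adjacent, so the outer vertices separate them. *)
Lemma flip_quad c y : global_quad e (setcell c y) (setcell (opp c) y)
  (setcell (c.1, ~~ c.2) y) (setcell (~~ c.1, c.2) y).
Proof.
pose C := [set i : 'I_N | outer i].
have sep : separating_partition e [set v0] [set v1] C.
  split.
  - apply/setP => i; rewrite !inE.
    by case: (vertexP i) => [->|->|->] //; rewrite ?eqxx ?orbT.
  - by rewrite disjoints_subset; apply/subsetP => i; rewrite !inE => /eqP->.
  - by rewrite disjoints_subset; apply/subsetP => i; rewrite !inE => /eqP->.
  - by rewrite disjoints_subset; apply/subsetP => i; rewrite !inE => /eqP->.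
  - move=> a [|b p]; rewrite !inE => /eqP->; first by [].
    by move=> /= /andP[eab _] _; move: eab; rewrite !inE /complete_bipartite2 /=; case: (ltnP b 2).
have gE x z : glue [set v0] [set v1] x z (setcell c y) =
    setcell ((cell x).1, (cell z).2) y.
  apply: state_eq => [|j oj]; last by rewrite ffunE !inE !outer_neq // !setcell_outer.
  by rewrite cell_setcell /cell !ffunE !inE.
have := GlobalQuad (setcell c y) (setcell (opp c) y) (setcell c y)
  (setcell (opp c) y) (setcell c y) sep.
by rewrite !gE !cell_setcell /=; case: (c).
Qed.

(** * Swaps inside cells and shifts between parity classes *)

Section Congruence.
Variable E : seq st -> seq st -> Prop.
Hypothesis mcE : move_congruence e E.

Definition supported c (y : st) s : bool :=
  [forall j : 'I_N, (outer j) ==> (0 < cnt j c (y j) s)].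

Lemma supportedP c y s :
  reflect (forall j, outer j -> 0 < cnt j c (y j) s) (supported c y s).
Proof. by apply: (iffP forallP) => h j; [apply/implyP|apply/implyP/h]. Qed.

(* Swaps inside a cell preserve the counts and bring together, one outer
   coordinate after the other, the coordinates of a supported state. *)
Lemma supported_pull c y s : supported c y s ->
  exists r, E s (setcell c y :: r) /\ same_cnt s (setcell c y :: r).
Proof.
move/supportedP => sy.
suff [z [r [Ezr szr cz /(_ N)hz]]] : exists z r, [/\ E s (z :: r),
    same_cnt s (z :: r), cell z = c &
    forall k, k <= N -> forall j, outer j -> j < k -> z j = y j :> nat].
  exists r; suff -> : setcell c y = z by [].
  apply: state_eq => [|j oj]; first by rewrite cell_setcell.
  by rewrite setcell_outer // hz.
suff H k : k <= N -> exists z r, [/\ E s (z :: r),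
    same_cnt s (z :: r), cell z = c &
    forall j, outer j -> j < k -> z j = y j :> nat].
  have [z [r [? ? ? hz]]] := H N (leqnn N); exists z, r; split => // k kN j oj jk.
  by apply: hz.
elim: k => [|k IH] kN.
  have := sy v2 isT; rewrite -has_count => /hasP[z zs /andP[/eqP cz _]].
  exists z, (rem z s); have p := perm_to_rem zs.
  by split => //; [apply: (mc_perm mcE) | apply: perm_same_cnt].
have [z [r [Ezr szr cz hz]]] := IH (ltnW kN).
pose j := Ordinal kN; have [oj|oj] := boolP (outer j); last first.
  by exists z, r; split => // i oi ik; move: oi ik oj => /=; lia.
have [zj|/eqP zj] := eqVneq (z j : nat) (y j).
  exists z, r; split => // i oi; rewrite ltnS leq_eqVlt => /orP[/eqP ik|/hz->//].
  by have -> : i = j by apply: val_inj.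
have := sy j oj; rewrite szr // cnt_cons (introF eqP zj) andbF add0n -has_count.
case/hasP => w wr /andP[/eqP cw /eqP wj].
have [|z' [w' [q cz' cw' h']]] := @swap_quad z w j oj; first by rewrite cz.
exists z', (w' :: rem w r); have p := perm_to_rem wr; split.
- apply: (mc_trans mcE) Ezr _; apply: (mc_trans mcE) (mc_quad_cat _ mcE q).
  by apply: (mc_perm mcE); rewrite perm_cons.
- move=> i b a oi; rewrite szr // !cnt_cons (perm_same_cnt p) // cnt_cons.
  rewrite cz' cw' cw cz; have [-> ->] := h' i oi; case: (i == j); lia.
- by rewrite cz'.
- move=> i oi; rewrite ltnS leq_eqVlt => /orP[/eqP ik|ik]; have [-> _] := h' i oi.
    by have -> : i = j by [apply: val_inj]; rewrite eqxx.
  by rewrite -val_eqE /= ltn_eqF // hz.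
Qed.

(** Induction on [s]: its first state is supported in [t] because the counts agree, so it can be
    pulled to the front of [t] and cancelled. *)
Lemma mc_same_cnt s t : same_cnt s t -> E s t.
Proof.
elim: s t => [|x s IH] t st_.
  have: size t = 0; last by move/size0nil ->; apply: (mc_perm mcE).
  apply/eqP; rewrite -leqn0 leqNgt; apply/negP.
  case: t st_ => // x t /(_ v2 (cell x) (x v2) isT).
  by rewrite cnt_cons !eqxx.
have [|r [Etr tr]] := @supported_pull (cell x) x t.
  by apply/supportedP => j oj; rewrite -st_ // cnt_cons !eqxx.
have xE : setcell (cell x) x = x.
  by apply: state_eq => [|j oj]; [rewrite cell_setcell|rewrite setcell_outer].
rewrite xE in Etr tr; apply: (mc_trans mcE) (mc_sym mcE Etr).
apply/(mc_cons mcE)/IH => j c a oj.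
by have := st_ j c a oj; rewrite tr // !cnt_cons; lia.
Qed.

(** Pull [y] out of both cells and apply [flip_quad]. Comparing the counts additively avoids
    truncated subtraction. *)
Lemma shift c y s : supported c y s -> supported (opp c) y s ->
  exists t, E s t /\ forall j c' a, outer j ->
    cnt j c' a t + (par c' == par c) && (y j == a :> nat) =
    cnt j c' a s + (par c' != par c) && (y j == a :> nat).
Proof.
move=> s1 s2; have [r [Er sr]] := supported_pull s1.
(* The pulled state lies in [c], so the counts at [opp c] are intact. *)
have rs2 : supported (opp c) y r.
  apply/supportedP => j oj; have /supportedP/(_ j oj) := s2.
  by rewrite sr // cnt_cons cell_setcell; case: (c) => -[] [].
have [r' [Er' sr']] := supported_pull rs2.
exists [:: setcell (c.1, ~~ c.2) y, setcell (~~ c.1, c.2) y & r']; split.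
  apply: (mc_trans mcE) Er _; apply: (mc_trans mcE) (mc_cons mcE _ Er') _.
  exact: mc_quad_cat mcE (flip_quad c y).
move=> j c' a oj; rewrite !cnt_cons sr // cnt_cons sr' // cnt_cons.
rewrite !cell_setcell !setcell_outer //.
by case: (c) (c') => -[] [] [[] []] /=; lia.
Qed.

End Congruence.

(** * Connecting multisets with the same margins *)

Definition free c s : bool :=
  [exists y : st, supported c y s && supported (opp c) y s].

(** Finite choice: the outer coordinates of a state are independent. *)
Lemma choose_state (P : 'I_N -> nat -> Prop) :
  (forall j, outer j -> exists a : 'I_(d j), P j a) ->
  exists y : st, forall j, outer j -> P j (y j).
Proof.
move=> h.
suff H (s : seq 'I_N) : exists f : 'I_N -> nat, forall j, j \in s ->
    outer j -> f j < d j /\ P j (f j).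
  have [f hf] := H (enum 'I_N); exists (mkstate f) => j oj.
  by have [|fj Pj] := hf j _ oj; rewrite ?mem_enum // mkstateE.
elim: s => [|i s [f hf]]; first by exists (fun=> 0).
have [oi|/negbTE oi] := boolP (outer i); last first.
  by exists f => j; rewrite inE => /orP[/eqP->|/hf//]; rewrite oi.
have [a Pa] := h i oi; exists (fun j => if j == i then a : nat else f j) => j.
rewrite inE; case: eqP => [-> _ _|_ /= /hf //]; split => //; exact: ltn_ord.
Qed.

(** An L1 distance, each absolute value being a sum of two truncated differences. One cell suffices:
    under equal margins the absolute differences are the same at all four. *)
Definition dist s t : nat :=
  \sum_(j : 'I_N | outer j) \sum_(a < d j)
    ((cnt j (false, false) a s - cnt j (false, false) a t) +
     (cnt j (false, false) a t - cnt j (false, false) a s)).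

Lemma ltn_dist c s s' t j0 a0 :
  same_margins e s t -> same_margins e s' t -> outer j0 ->
  (forall j a, outer j -> (cnt j c a s' - cnt j c a t) + (cnt j c a t - cnt j c a s')
     <= (cnt j c a s - cnt j c a t) + (cnt j c a t - cnt j c a s)) ->
  (cnt j0 c a0 s' - cnt j0 c a0 t) + (cnt j0 c a0 t - cnt j0 c a0 s')
     < (cnt j0 c a0 s - cnt j0 c a0 t) + (cnt j0 c a0 t - cnt j0 c a0 s) ->
  dist s' t < dist s t.
Proof.
move=> m m' o0 hle hlt.
have a0d : a0 < d j0 by rewrite ltnNge; apply/negP => da;
  move: hlt; rewrite !cnt_large.
have eqc r j a : same_margins e r t -> outer j ->
    (cnt j (false, false) a r - cnt j (false, false) a t) +
    (cnt j (false, false) a t - cnt j (false, false) a r) =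
    (cnt j c a r - cnt j c a t) + (cnt j c a t - cnt j c a r).
  move=> mr oj; have := cnt_diff c (false, false) a oj mr; case: ifP => _; lia.
apply: (@ltn_sum_at _ _ _ _ j0) => // [j oj|].
  by apply: leq_sum => a _; rewrite !eqc //; exact: hle.
by apply: (@ltn_sum_at _ _ _ _ (Ordinal a0d)) => // [a _|]; rewrite !eqc //=;
  exact: hle.
Qed.

Lemma dist0_same_cnt s t : same_margins e s t -> dist s t = 0 -> same_cnt s t.
Proof.
move=> m /eqP; rewrite sum_nat_eq0 => /forall_inP h j c a oj.
have [ad|?] := ltnP a (d j); last by rewrite !cnt_large.
have /eqP/eqP := h j oj; rewrite sum_nat_eq0 => /forall_inP/(_ (Ordinal ad) isT) /=.
by have := cnt_diff c (false, false) a oj m; case: ifP => _; lia.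
Qed.

(** With the margins built into the relation, [shift] also certifies that they are preserved. *)
Lemma margins_congruence E : move_congruence e E ->
  move_congruence e (fun s t => E s t /\ same_margins e s t).
Proof.
move=> mcE; split.
- by move=> s t p; split; [apply: (mc_perm mcE)|move=> W x0 _; apply/permP].
- by move=> s t [h m]; split; [apply: (mc_sym mcE)|move=> W x0 /m].
- move=> s t r [h m] [h' m']; split; first exact: (mc_trans mcE) h h'.
  by move=> W x0 cW; rewrite m // m'.
- move=> x s t [h m]; split; first exact: (mc_cons mcE).
  by move=> W x0 cW /=; rewrite m.
- by move=> x1 x2 x3 x4 q; split; [apply: (mc_quad mcE)|apply: quad_margins].
Qed.

Lemma same_margins_sym s t : same_margins e s t -> same_margins e t s.
Proof. by move=> h W x0 /h. Qed.

Lemma same_margins_trans s t r :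
  same_margins e s t -> same_margins e t r -> same_margins e s r.
Proof. by move=> h h' W x0 cW; rewrite h // h'. Qed.

(** The margins determine the total of two adjacent cells, so a deficit at one is an excess at the
    other. *)
Lemma same_margins_ncell s t : same_margins e s t ->
  (exists c, ncell c s != ncell c t) -> exists c, ncell c t < ncell c s.
Proof.
move=> m [c]; rewrite neq_ltn => /orP[h|h]; last by exists c.
exists (c.1, ~~ c.2); move: h; rewrite -!(sum_cnt v2) => h.
suff: ncell c s + ncell (c.1, ~~ c.2) s = ncell c t + ncell (c.1, ~~ c.2) t.
  by rewrite -!(sum_cnt v2); lia.
rewrite -!(sum_cnt v2) -!big_split /=; apply: eq_bigr => a _.
by have [] := margin_cnt c a (isT : outer v2) m.
Qed.

(* A shift towards [t] brings the counts closer. If the cell counts agree, two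
   opposite shifts differing in one outer coordinate do. *)
Lemma mc_same_margins E s t : move_congruence e E -> same_margins e s t ->
  (exists c, ncell c s != ncell c t) \/ (exists c, free c s) -> E s t.
Proof.
move=> mcE; have mcM := margins_congruence mcE.
have [n] := ubnP (dist s t); elim: n s => // n IH s; rewrite ltnS => dn m h.
have [/existsP[c ltc]|noc] := boolP [exists c, ncell c t < ncell c s].
  (* A larger cell total gives each outer vertex a value in excess in [s]. The excess is the same at
     [opp c], so the resulting state can be shifted. *)
  have [y hy] : exists y : st, forall j, outer j -> cnt j c (y j) t < cnt j c (y j) s.
    apply: (@choose_state (fun j a => cnt j c a t < cnt j c a s)) => j oj.
    by apply: exists_ltn_sum; rewrite !sum_cnt.
  have sy c' : par c' = par c -> supported c' y s.
    move=> pc; apply/supportedP => j oj.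
    by have := cnt_diff c c' (y j) oj m; have := hy j oj; rewrite pc eqxx; lia.
  have [|s' [[Es ms] cs]] := shift mcM (sy c erefl) (sy (opp c) _).
    by case: (c) => -[] [].
  have ms' : same_margins e s' t by apply: same_margins_trans m; apply: same_margins_sym.
  apply: (mc_trans mcE) Es _; apply: IH => //; last first.
    (* The shift has put [y] in both cells of the other class, which is therefore free. *)
    right; exists (flip c); apply/existsP; exists y.
    have sf c' : par c' != par c -> supported c' y s'.
      move=> pc; apply/supportedP => j oj.
      by have := cs j c' (y j) oj; rewrite (negbTE pc) eqxx /=; lia.
    by rewrite !sf //; case: (c) => -[] [].
  have hy2 := hy v2 isT.
  apply: leq_trans dn; apply: (@ltn_dist c _ _ _ v2 (y v2)) => //.
    move=> j a oj; have := cs j c a oj; rewrite eqxx /=.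
    have: y j = a :> nat -> cnt j c a t < cnt j c a s by move=> <-; apply: hy.
    move: (cnt j c a s) (cnt j c a s') (cnt j c a t) => p q w.
    by case: eqP => [ya /(_ ya)|_ _]; clear; lia.
  move: (cs v2 c (y v2) isT) hy2; rewrite !eqxx /=.
  by move: (cnt _ _ _ s) (cnt _ _ _ s') (cnt _ _ _ t) => p q w; clear; lia.
have ncE c : ncell c s = ncell c t.
  apply/eqP; apply/negPn/negP => hc; move/negP: noc; apply; apply/existsP.
  by apply: same_margins_ncell m _; exists c.
have [c fc] : exists c, free c s.
  by case: h => // -[c]; rewrite ncE eqxx.
have [d0|d_pos] := posnP (dist s t).
  by apply: (mc_same_cnt mcE) => j c' a; apply: dist0_same_cnt.
have [j0 [a0 [o0 ha0]]] : exists j a, outer j /\ cnt j c a s != cnt j c a t.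
  have : [exists j : 'I_N, [exists a : 'I_(d j), outer j && (cnt j c a s != cnt j c a t)]].
    apply: contraTT d_pos; rewrite negb_exists -leqNgt leqn0 sum_nat_eq0 => /forallP h0.
    apply/forall_inP => j oj; rewrite sum_nat_eq0; apply/forallP => a /=.
    have := h0 j; rewrite negb_exists => /forallP/(_ a); rewrite oj negbK => /eqP.
    by have := cnt_diff c (false, false) a oj m; case: ifP => _; lia.
  by move=> /existsP[j /existsP[a /andP[oj ha]]]; exists j, a.
have sumE : \sum_(a < d j0) cnt j0 c a s = \sum_(a < d j0) cnt j0 c a t.
  by rewrite !sum_cnt ncE.
have a0d : a0 < d j0 by rewrite ltnNge; apply/negP => da; rewrite !cnt_large ?eqxx in ha0.
(* At [j0] the value [a1] is in excess in [s] and [a2] is lacking: a free state is shifted out with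
   [a1] and back with [a2]. *)
have [a1 ha1] := @sum_eq_exists_ltn _ _ _ (Ordinal a0d) (esym sumE) (contra_neq esym ha0).
have [a2 ha2] := @sum_eq_exists_ltn _ _ _ (Ordinal a0d) sumE ha0.
have /existsP[y /andP[/supportedP fy1 /supportedP fy2]] := fc.
pose y1 := setcoord j0 a1 y; pose y2 := setcoord j0 a2 y.
have y1E j : y1 j = (if j == j0 then a1 : nat else y j) :> nat by rewrite setcoordE.
have y2E j : y2 j = (if j == j0 then a2 : nat else y j) :> nat by rewrite setcoordE.
have sy c' : par c' = par c -> supported c' y1 s.
  move=> pc; apply/supportedP => j oj; rewrite y1E; case: eqP => [->|_].
    by have := cnt_diff c c' a1 o0 m; rewrite pc eqxx; lia.
  have : (c' == c) || (c' == opp c) by case: (c) c' pc => -[] [] [[] []].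
  by case/orP => /eqP->; [apply: fy1|apply: fy2].
have [|s1 [[E1 m1] cs1]] := shift mcM (sy c erefl) (sy (opp c) _).
  by case: (c) => -[] [].
(* Away from [j0] the first shift supplied the coordinates; at [j0], a lack of [a2] in the class of
   [c] is an excess in the other class. *)
have sy1 c' : par c' != par c -> supported c' y2 s1.
  move=> pc; apply/supportedP => j oj; have := cs1 j c' (y2 j) oj.
  rewrite (negbTE pc) y1E y2E; case: eqP => [->|_]; last by rewrite eqxx; lia.
  by have := cnt_diff c c' a2 o0 m; rewrite eq_sym (negbTE pc); lia.
have pflip : par (flip c) != par c by case: (c) => -[] [].
have [|s2 [[E2 m2] cs2]] := shift mcM (sy1 (flip c) pflip) (sy1 (opp (flip c)) _).
  by case: (c) => -[] [].
have cs j c' a : par c' = par c -> outer j ->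
    cnt j c' a s2 + ((j == j0) && (a1 == a :> nat)) =
    cnt j c' a s + ((j == j0) && (a2 == a :> nat)).
  move=> pc oj; have := cs1 j c' a oj; have := cs2 j c' a oj.
  rewrite pc eqxx [par c == _]eq_sym pflip (negbTE pflip) y1E y2E.
  by case: (j == j0) => /=; lia.
have ms2 : same_margins e s2 t.
  apply: same_margins_trans m; apply: same_margins_sym.
  exact: same_margins_trans m1 m2.
apply: (mc_trans mcE) (mc_trans mcE E1 E2) _; apply: IH => //; last first.
  right; exists c; apply/existsP; exists y2.
  have s2y c' : par c' = par c -> supported c' y2 s2.
    move=> pc; apply/supportedP => j oj; have := cs2 j c' (y2 j) oj.
    by rewrite pc [par c == _]eq_sym pflip (negbTE pflip) eqxx; lia.
  by rewrite !s2y //; case: (c) => -[] [].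
apply: leq_trans dn; apply: (@ltn_dist c _ _ _ j0 a1) => //.
  move=> j a oj; have := cs j c a erefl oj; case: (j =P j0) => [->|_] /=; last by lia.
  case: (nat_of_ord a1 =P a) => [<-|_]; case: (nat_of_ord a2 =P a) => [h2|_];
    try (subst a || move: ha2; rewrite ?h2); lia.
have := cs j0 c a1 erefl o0; rewrite !eqxx /=.
case: (nat_of_ord a2 =P a1) => [h2|_]; last lia.
by move: ha2; rewrite h2; lia.
Qed.

(** * Shape of the moves and obstructions to shifts *)

Definition opposite (x x' : st) : Prop :=
  cell x' = opp (cell x) /\ forall j, outer j -> x' j = x j.

Lemma opposite_cells (x x' : st) : (forall j, outer j -> x' j = x j) ->
  x v0 != x' v0 -> x v1 != x' v1 -> opposite x x'.
Proof.
move=> h h0 h1; split=> //; rewrite /cell /opp /=.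
move: h0 h1; rewrite -!val_eqE /= !coord0 !coord1.
by case: (cell x) (cell x') => -[] [] [[] []].
Qed.

(** No edge joins A to B, so in a nontrivial move they lie on one side of the graph. On the outer
    side, the hubs belong to C and the counts are kept; otherwise A and B are single hubs. *)
Lemma quad_cases x1 x2 x3 x4 : global_quad e x1 x2 x3 x4 ->
  same_cnt [:: x1; x2] [:: x3; x4] \/ opposite x1 x2 /\ opposite x3 x4.
Proof.
move=> q; have [/(quad_trivial q)/perm_same_cnt ?|] :=
  boolP ((x1 == x3) || (x1 == x4) || (x2 == x3) || (x2 == x4)); first by left.
rewrite !negb_or -!andbA => /and4P[n13 n14 _ _].
have pw := quad_pointwise _ q.
case: q n13 n14 pw => A B C xA xA' xB xB' xC [U dAB dAC dBC sep] n13 n14 pw.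
have noedge a b : a \in A -> b \in B -> (a < 2) = (b < 2).
  move=> aA bB; have [//|eab] := eqVneq (a < 2) (b < 2).
  have := sep a [:: b] aA; rewrite /= /complete_bipartite2 eab => /(_ isT bB).
  by rewrite /= (disjointFr dAC aA) (disjointFr dBC bB).
have [a Aa] : exists a, a \in A.
  apply/set0Pn; apply: contraNneq n14 => A0; apply/eqP/ffunP => v.
  by rewrite !ffunE A0 inE.
have [b Bb] : exists b, b \in B.
  apply/set0Pn; apply: contraNneq n13 => B0; apply/eqP/ffunP => v.
  by rewrite !ffunE B0 inE.
have [a2|a2] := ltnP a 2; last first.
  left=> j c k oj; have notAB (h : 'I_N) : h < 2 -> (h \in A = false) * (h \in B = false).
    move=> h2; split; apply/negP => hX.
      by have := noedge _ _ hX Bb; rewrite -(noedge _ _ Aa Bb) h2 ltnNge a2.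
    by have := noedge _ _ Aa hX; rewrite h2 ltnNge a2.
  have cellE x z : cell (glue A B x z xC) = cell xC by rewrite /cell !ffunE !notAB.
  by rewrite !cnt_cons !cellE; case: (pw j) => -[-> ->] //; rewrite addnCA.
have out j : outer j -> (j \in A = false) * (j \in B = false).
  move=> oj; split; apply/negP => jX.
    by have := noedge _ _ jX Bb; rewrite -(noedge _ _ Aa Bb) a2 ltnNge oj.
  by have := noedge _ _ Aa jX; rewrite a2 ltnNge oj.
have b2 : b < 2 by rewrite -(noedge _ _ Aa Bb).
have bA : b \in A = false by rewrite (disjointFl dAB Bb).
have ab : a != b by apply: contraTneq Aa => ->; rewrite bA.
have hubs (v : 'I_N) : outer v \/ (v = a \/ v = b).
  have [?|v2'] := leqP 2 v; [by left | right].
  have : (v == a) || (v == b) by move: ab; rewrite -!val_eqE /=; lia.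
  by case/orP => /eqP ->; auto.
have nA : xA a != xA' a.
  apply: contraNneq n14 => h; apply/eqP/ffunP => v; rewrite !ffunE.
  by case: (hubs v) => [ov|[->|->]]; rewrite ?(out v ov) ?Aa ?bA ?Bb ?h.
have nB : xB b != xB' b.
  apply: contraNneq n13 => h; apply/eqP/ffunP => v; rewrite !ffunE.
  by case: (hubs v) => [ov|[->|->]]; rewrite ?(out v ov) ?Aa ?bA ?Bb ?h.
have vab (v : 'I_N) : v < 2 -> (v == a) || (v == b).
  by case: (hubs v) => [ov|[->|->]]; rewrite ?eqxx ?orbT // ltnNge ov.
right; split; apply: opposite_cells => [j oj||].
1,4: by rewrite !ffunE !out.
1,3: by case/orP: (vab v0 isT) => /eqP->; rewrite !ffunE ?Aa ?bA ?Bb // eq_sym.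
all: by case/orP: (vab v1 isT) => /eqP->; rewrite !ffunE ?Aa ?bA ?Bb // eq_sym.
Qed.

(** If every outer vertex had a value occurring in both cells, these values would form a state
    supported in both. *)
Lemma not_free c s : ~~ free c s -> exists2 j, outer j &
  forall a, (cnt j c a s == 0) || (cnt j (opp c) a s == 0).
Proof.
move=> nf.
have [/existsP[j /andP[oj /forallP hj]]|/existsPn hj] := boolP [exists j : 'I_N,
    (outer j) && [forall a : 'I_(d j), (cnt j c a s == 0) || (cnt j (opp c) a s == 0)]].
  exists j => // a; have [ad|?] := ltnP a (d j); last by rewrite cnt_large.
  exact: (hj (Ordinal ad)).
have [j oj|y hy] := @choose_state (fun j a => 0 < cnt j c a s /\ 0 < cnt j (opp c) a s).
  have := hj j; rewrite oj => /forallPn[a]; rewrite negb_or -!lt0n => /andP[? ?].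
  by exists a.
case/existsP: nf; exists y; apply/andP; split; apply/supportedP => j oj;
  by case: (hy j oj).
Qed.

(** * Positive margins for four vertices *)

Definition positive_margins s : Prop :=
  forall (W : {set 'I_N}) x0, clique e W -> 0 < count (agree W x0) s.

Lemma positive_cnt j c a s : positive_margins s -> outer j -> a < d j ->
  0 < cnt j c a s + cnt j (c.1, ~~ c.2) a s /\
  0 < cnt j c a s + cnt j (~~ c.1, c.2) a s.
Proof.
move=> pos oj ad; have [<- <-] := count_spoke c s oj ad.
by split; apply/pos/clique_spoke.
Qed.

(** [s] and [t] differ by the same amount at [c] and [opp c], and one of the two counts of [s]
    vanishes, so [s] has no excess; equal cell totals then exclude a deficit. *)
Lemma not_free_cnt j c s t : outer j -> same_margins e s t ->
  ncell c s = ncell c t ->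
  (forall a, (cnt j c a s == 0) || (cnt j (opp c) a s == 0)) ->
  forall c' a, cnt j c' a s = cnt j c' a t.
Proof.
move=> oj m nc h.
have le a : cnt j c a s <= cnt j c a t.
  have := cnt_diff c (opp c) a oj m; rewrite ifT; last by case: (c) => -[] [].
  by case/orP: (h a) => /eqP; lia.
have E a : cnt j c a s = cnt j c a t.
  have [ad|?] := ltnP a (d j); last by rewrite !cnt_large.
  apply/eqP; rewrite eqn_leq le leqNgt; apply/negP => lt.
  have : \sum_(b < d j) cnt j c b s < \sum_(b < d j) cnt j c b t.
    exact: (@ltn_sum_at _ _ _ _ (Ordinal ad)).
  by rewrite !sum_cnt nc ltnn.
by move=> c' a; have := cnt_diff c c' a oj m; have := E a; case: ifP; lia.
Qed.

Lemma mc_positive_margins E s t : move_congruence e E -> N = 4 ->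
  positive_margins s -> same_margins e s t -> E s t.
Proof.
move=> mcE N4 pos m.
have [/existsP nc|/existsPn nc] := boolP [exists c, ncell c s != ncell c t].
  by apply: mc_same_margins => //; left.
have [/existsP fc|/existsPn nf] := boolP [exists c, free c s].
  by apply: mc_same_margins => //; right.
have [j oj hj] := not_free (nf (false, false)).
have [j' oj' hj'] := not_free (nf (false, true)).
(* If the obstructions coincided, the value 0 at [j] would be absent from two adjacent cells,
   against a positive edge margin. *)
have jj' : j != j'.
  apply/eqP => jE; subst j'.
  have [] := positive_cnt (false, false) pos oj (d_gt0 j).
  have [] := positive_cnt (true, true) pos oj (d_gt0 j).
  by move: (hj 0) (hj' 0) => /= /orP[]/eqP-> /orP[]/eqP->.
apply: (mc_same_cnt mcE) => i c a oi.
(* With four vertices, [j] and [j'] are the only outer ones. *)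
have : (i == j) || (i == j').
  move: (ltn_ord i) (ltn_ord j) (ltn_ord j') jj'; rewrite -!val_eqE /=; lia.
have ncE b : ncell b s = ncell b t by apply/eqP; have := nc b; rewrite negbK.
by case/orP => /eqP->; [apply: not_free_cnt hj c a | apply: not_free_cnt hj' c a].
Qed.

(** * Pairs of states satisfying a local condition *)

Section LocalPredicate.
Variable P : 'I_N -> bool * bool -> nat -> bool.

Definition locally (x : st) : bool :=
  [forall j : 'I_N, (outer j) ==> P j (cell x) (x j)].

Lemma locallyP x : reflect (forall j, outer j -> P j (cell x) (x j)) (locally x).
Proof. by apply: (iffP forallP) => h j; [apply/implyP|apply/implyP/h]. Qed.

(** Whether both states satisfy the condition depends only on which counts are positive, and moves
    not between opposite pairs keep the counts. *)
Lemma quad_locally x1 x2 x3 x4 :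
  (forall x x', opposite x x' -> ~~ (locally x && locally x')) ->
  global_quad e x1 x2 x3 x4 ->
  same_cnt [:: x1; x2] [:: x3; x4] /\ locally x1 && locally x2 = locally x3 && locally x4
  \/ locally x1 && locally x2 = false /\ locally x3 && locally x4 = false.
Proof.
move=> nP /quad_cases[h|[/nP/negbTE h /nP/negbTE h']]; [left | by right].
have all_loc (x x' : st) : locally x && locally x' <->
    forall j c a, outer j -> 0 < cnt j c a [:: x; x'] -> P j c a.
  split=> [/andP[/locallyP hx /locallyP hx'] j c a oj | hxx].
    rewrite !cnt_cons; case: (boolP (_ && _)) => [/andP[/eqP<- /eqP<-] _|_ /=].
      exact: hx.
    by case: (boolP (_ && _)) => [/andP[/eqP<- /eqP<-] _|//]; exact: hx'.
  by apply/andP; split; apply/locallyP => j oj; apply: hxx => //;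
    rewrite !cnt_cons !eqxx /= ?addnS.
split=> //; apply/idP/idP => /all_loc h1; apply/all_loc => j c a oj.
  by rewrite -h //; apply: h1.
by rewrite h //; apply: h1.
Qed.

End LocalPredicate.
(* The states satisfying [rigid_at] realize all margins, but two of them are
   never opposite, since the value at [v2] or at [v3] determines the cell once
   its parity is known. Hence the moves cannot exchange the hubs, and the
   correlation between [v4] and the parity of the cell, invisible in the
   margins, is preserved. *)
Section Counterexample.
Hypothesis N5 : 4 < N.

Definition v3 : 'I_N := Ordinal (leq_trans (isT : 3 < 4) hN).
Definition v4 : 'I_N := Ordinal N5.

Definition rigid_at j c (a : nat) : bool :=
  if j == v2 then par c ==> ((0 < a) == c.1)
  else if j == v3 then ~~ par c ==> ((0 < a) == c.1) else true.

Lemma rigidP (x : st) : reflect ((0 < (if par (cell x) then x v2 : nat else x v3)) = (cell x).1)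
  (locally rigid_at x).
Proof.
apply: (iffP (locallyP _ _)) => [h | h j oj].
  case: ifP => pc; first by have := h v2 isT; rewrite /rigid_at eqxx pc => /eqP.
  by have := h v3 isT; rewrite /rigid_at eqxx pc => /eqP.
rewrite /rigid_at; case: eqP => [->|_]; last case: eqP => [->|_] //.
  by apply/implyP => pc; rewrite pc in h; apply/eqP.
by apply/implyP => /negbTE pc; rewrite pc in h; apply/eqP.
Qed.

Lemma rigid_opposite (x x' : st) : opposite x x' ->
  ~~ (locally rigid_at x && locally rigid_at x').
Proof.
case=> cx xx'; apply/negP => /andP[/rigidP h /rigidP]; rewrite cx !xx' //.
have -> : par (opp (cell x)) = par (cell x) by case: (cell x) => -[] [].
by rewrite h; case: (cell x) => -[] [].
Qed.

Lemma move_rigid (u w : 'cV[nat]_#|state d|) :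
  clos_refl_trans _ (@move_step _ e d) u w ->
  forall s, u = vecs s -> all (locally rigid_at) s ->
  exists t, [/\ w = vecs t, same_cnt s t & all (locally rigid_at) t].
Proof.
elim=> {u w} [u w uw | u | u w u' _ IH1 _ IH2] s us rs.
- have [<-|[x1 [x2 [x3 [x4 [r [q ur w'r]]]]]]] := move_step_quad uw.
    by exists s.
  have p : perm_eq s [:: x3, x4 & r] by apply: vecs_perm; rewrite -us.
  have := rs; rewrite (perm_all _ p) => /and3P[r3 r4 rr].
  exists [:: x1, x2 & r]; split => //.
    move=> j c a oj; rewrite (perm_same_cnt p) //.
    have [[h _]|[_]] := quad_locally rigid_opposite q; last by rewrite r3 r4.
    by have := h j c a oj; rewrite !cnt_cons; lia.
  have [[_]|[_]] := quad_locally rigid_opposite q; last by rewrite r3 r4.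
  by rewrite r3 r4 => /andP[r1 r2]; apply/and3P.
- by exists s.
- have [t [wt st_ rt]] := IH1 s us rs; have [t' [? tt' rt']] := IH2 t wt rt.
  by exists t'; split => // j c a oj; rewrite st_ // tt'.
Qed.

(** The outer coordinates other than [v4] copy the first hub, which makes the state rigid; [v4]
    carries the mark. *)
Definition marked c (i : bool) : st :=
  mkstate (fun v => if v == v4 then i : nat else if v == v1 then c.2 : nat else c.1).

Lemma markedE c i v : marked c i v =
  (if v == v4 then i : nat else if v == v1 then c.2 : nat else c.1) :> nat.
Proof.
rewrite mkstateE //; apply: leq_trans (hd v).
by case: (v == v4) (v == v1) c i => -[] [[] []] [].
Qed.

Lemma cell_marked c i : cell (marked c i) = c.
Proof. by rewrite /cell !markedE; case: c => -[] []. Qed.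

Lemma rigid_marked c i : locally rigid_at (marked c i).
Proof. by apply/rigidP; rewrite cell_marked !markedE; case: c => -[] []. Qed.

(** The rigid states make all margins positive; the marked states correlate [v4] with the parity of
    the cell, in one of two ways according to [b]. *)
Definition witness (b : bool) : seq st :=
  enum (locally rigid_at) ++
  [seq marked c (par c (+) b) | c <-
    [:: (false, false); (false, true); (true, false); (true, true)]].

Lemma clique_hub W : clique e W -> v0 \notin W \/ v1 \notin W.
Proof.
move/forall_inP => cW; have [W0|] := boolP (v0 \in W); [right|by left].
by apply/negP => W1; have /forall_inP/(_ _ W1) := cW _ W0.
Qed.

Lemma clique_outer W j j' : clique e W -> outer j -> outer j' -> j != j' ->
  j \notin W \/ j' \notin W.
Proof.
move/forall_inP => cW oj oj' jj'; have [Wj|] := boolP (j \in W); [right|by left].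
apply/negP => Wj'; have /forall_inP/(_ _ Wj') := cW _ Wj.
by rewrite jj' /complete_bipartite2 (ltnNge j 2) (ltnNge j' 2) oj oj'.
Qed.

Lemma agree_marked (W : {set 'I_N}) x0 c c' i i' :
  {in W, forall v, marked c i v = marked c' i' v :> nat} ->
  agree W x0 (marked c i) = agree W x0 (marked c' i').
Proof.
move=> h; apply/agreeP/agreeP => k v Wv; rewrite -k //; apply/val_inj => /=;
  by rewrite h.
Qed.

(** Without [v4] a clique does not see the marks. With it, the clique has no other outer vertex and
    misses a hub, and two cells differing only at that hub carry both marks for either [b]. *)
Lemma witness_margins : same_margins e (witness true) (witness false).
Proof.
move=> W x0 cW; rewrite /witness !count_cat; congr (_ + _) => /=.
have [W4|W4] := boolP (v4 \in W); last first.
  have mE c i i' : agree W x0 (marked c i) = agree W x0 (marked c i').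
    apply: agree_marked => v Wv; rewrite !markedE; case: eqP => // vE.
    by rewrite -vE Wv in W4.
  by rewrite !(mE _ true false).
have hubs v : v \in W -> v != v4 -> v < 2.
  move=> Wv v4v; rewrite ltnNge; apply/negP => ov.
  by case: (clique_outer cW (isT : outer v4) ov _); rewrite ?W4 ?Wv 1?eq_sym.
have [W0|W1] := clique_hub cW.
  have mE p p' q i : agree W x0 (marked (p, q) i) = agree W x0 (marked (p', q) i).
    apply: agree_marked => v Wv; rewrite !markedE; case: eqP => // /eqP v4v.
    case: (vertexP v) => [vE|->//|]; first by rewrite vE (negbTE W0) in Wv.
    by rewrite leqNgt hubs.
  by rewrite !(mE true false); lia.
have mE p q q' i : agree W x0 (marked (p, q) i) = agree W x0 (marked (p, q') i).
  apply: agree_marked => v Wv; rewrite !markedE; case: eqP => // /eqP v4v.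
  by case: eqP => // vE; rewrite -vE Wv in W1.
by rewrite !(mE _ true false); lia.
Qed.

(** A clique misses a hub and one of [v2], [v3]; these two coordinates can be chosen to make any
    state rigid. *)
Lemma witness_positive b : positive_margins (witness b).
Proof.
move=> W x0 cW; rewrite count_cat; apply: ltn_addr; rewrite -has_count; apply/hasP.
pose fix_ (h o : 'I_N) (p q : bool) : st :=
  mkstate (fun v => if v == h then p : nat else if v == o then q : nat else x0 v).
have fixE h o p q v : fix_ h o p q v =
    (if v == h then p : nat else if v == o then q : nat else x0 v) :> nat.
  rewrite mkstateE //; do 2?[case: ifP => _]; rewrite ?ltn_ord //;
  by apply: leq_trans (hd v); case: (p); case: (q).
suff [h [o [p [q [hW oW rx]]]]] : exists h o p q,
    [/\ h \notin W, o \notin W & locally rigid_at (fix_ h o p q)].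
  exists (fix_ h o p q); first by rewrite mem_enum.
  apply/agreeP => v Wv; apply/val_inj; rewrite /= fixE.
  case: eqP => [vE|_]; first by rewrite -vE Wv in hW.
  by case: eqP => [vE|_] //; rewrite -vE Wv in oW.
pose p0 := 0 < x0 v0; pose p1 := 0 < x0 v1.
have [o2|o3] := clique_outer cW (isT : outer v2) (isT : outer v3) isT;
  have [h0|h1] := clique_hub cW.
(* The hub makes the cell odd if [v2] is missed and even if [v3] is, so that rigidity constrains the
   missed outer vertex. *)
- exists v0, v2, (~~ p1), (~~ p1); split => //; apply/rigidP.
  by rewrite /par /cell !fixE /=; case: (x0 v1 : nat) @p1 => [|?].
- exists v1, v2, (~~ p0), p0; split => //; apply/rigidP.
  by rewrite /par /cell !fixE /=; case: (x0 v0 : nat) @p0 => [|?].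
- exists v0, v3, p1, p1; split => //; apply/rigidP.
  by rewrite /par /cell !fixE /=; case: (x0 v1 : nat) @p1 => [|?].
- exists v1, v3, p0, p0; split => //; apply/rigidP.
  by rewrite /par /cell !fixE /=; case: (x0 v0 : nat) @p0 => [|?].
Qed.

Lemma witness_disconnected :
  ~ clos_refl_trans _ (@move_step _ e d) (vecs (witness false)) (vecs (witness true)).
Proof.
move/move_rigid => /(_ _ erefl) [|t [wt st_ _]].
  rewrite all_cat; apply/andP; split; first by apply/allP => x; rewrite mem_enum.
  by rewrite all_map; apply/allP => c _; apply: rigid_marked.
(* The mark in the cell (0,0) is [b], so the counts of 0 at [v4] there differ by one. *)
have /perm_same_cnt := vecs_perm wt => /(_ v4 (false, false) 0 isT).
rewrite -st_ // /cnt !count_cat /= !cell_marked !markedE /=; lia.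
Qed.

End Counterexample.

(** * A proper face containing a multiset without shifts *)

Section StuckFunctional.
Local Open Scope ring_scope.
Variable R : realDomainType.

Definition hub_indicator (h j : 'I_N) (p : bool) (B : pred nat) (x : st) : R :=
  ((x h == p :> nat) && B (x j))%:R.

Lemma margin_hub_indicator (h j : 'I_N) p B : (h < 2)%N -> outer j ->
  margin_function e (hub_indicator h j p B).
Proof.
move=> h2 oj.
(* The pair [(p, p)] gives both hubs the coordinate [p], so the same sum serves either hub. *)
apply: (@eq_margin_function _ _ _ _
  (fun x => \sum_(a < d j | B a) (agree [set h; j] (spoke j (p, p) a) x)%:R)).
  move=> x; rewrite /hub_indicator.
  have hj : (h == j) = false by apply/eqP => hj; move: oj; rewrite -hj leqNgt h2.
  have aE (a : 'I_(d j)) : agree [set h; j] (spoke j (p, p) a) x =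
      (x h == p :> nat) && (x j == a).
    rewrite agree_spoke /spoke !setcoordE // eqxx hj -val_eqE; congr ((_ == _) && _).
    have [->|->|] := vertexP h; last by rewrite leqNgt h2.
      by rewrite coord0 cell_setcell.
    by rewrite coord1 cell_setcell.
  have [Bx|nBx] := boolP (B (x j)).
    rewrite andbT (bigD1 (x j)) //= aE eqxx andbT big1 ?addr0 // => a /andP[_ ax].
    by rewrite aE [x j == a]eq_sym (negbTE ax) andbF.
  rewrite andbF big1 // => a Ba; rewrite aE.
  by case: (x j =P a) => [xa|_]; rewrite ?andbF //; rewrite xa Ba in nBx.
by apply: margin_function_sum => a _; apply/margin_function_agree/clique_spoke.
Qed.

(* For a multiset without free parities the cells (0,0) and (1,1) are never
   both occupied over a value of some [j], nor (0,1) and (1,0) over a value of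
   some [j']. The indicator of these unoccupied cells is a margin function: with
   0/1 hub coordinates s, t it is [x j' in A] t + [x j' not in A] s +
   [x j in B] (1 - s - t), where 1 - s - t = [s = 0] - [t = 1]. *)
Lemma stuck_functional (s : seq st) : (forall c, ~~ free c s) ->
  exists f : st -> R, [/\ margin_function e f, forall x, 0 <= f x,
    {in s, forall x, f x = 0} & exists x, f x != 0].
Proof.
move=> nf; have [j oj hj] := not_free (nf (false, false)).
have [j' oj' hj'] := not_free (nf (false, true)).
(* A value outside [A] occurs in the cell (0,1), hence by the obstruction at [j'] not in (1,0);
   likewise for [B] with (0,0) and (1,1). *)
pose A a := cnt j' (false, true) a s == 0%N.
pose B a := cnt j (false, false) a s == 0%N.
pose f x : R := hub_indicator v1 j' true A x + hub_indicator v0 j' true (predC A) x +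
  (hub_indicator v0 j false B x - hub_indicator v1 j true B x).
have fE x : f x = match cell x with
  | (false, true) => (A (x j'))%:R | (true, false) => (~~ A (x j'))%:R
  | (false, false) => (B (x j))%:R | (true, true) => (~~ B (x j))%:R end.
  rewrite /f /hub_indicator !coord0 !coord1 (_ : predC A _ = ~~ A (x j')) //.
  by case: (cell x) => -[] [] /=; case: (A _); case: (B _);
    rewrite /= ?(sub0r, oppr0, addr0, add0r, subrr).
have cnt_pos i x : x \in s -> (0 < cnt i (cell x) (x i) s)%N.
  by move=> xs; rewrite -has_count; apply/hasP; exists x; rewrite ?eqxx.
exists f; split.
- apply: margin_functionD; [apply: margin_functionD | apply: margin_functionB];
    exact: margin_hub_indicator.
- by move=> x; rewrite fE; case: (cell x) => -[] [].
- move=> x xs; have := cnt_pos j x xs; have := cnt_pos j' x xs.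
  rewrite fE; case: (cell x) => -[] [] h h'.
  + have := hj (x j); rewrite /opp /= -/(B _).
    by rewrite -[(cnt _ (true, true) _ _ == _)]negbK -lt0n h' orbF => ->.
  + have := hj' (x j'); rewrite /opp /= -/(A _).
    by rewrite -[(cnt _ (true, false) _ _ == _)]negbK -lt0n h orbF => ->.
  + by rewrite /A eqn0Ngt h.
  + by rewrite /B eqn0Ngt h'.
(* On the two odd cells [f] is the indicator of [A] and of its complement, so one of them gives
   1. *)
- pose x0 := mkstate (fun=> 0%N).
  exists (setcell (~~ A (x0 j'), A (x0 j')) x0).
  by rewrite fE cell_setcell !setcell_outer //; case: (A (x0 j')); exact: oner_neq0.
Qed.

End StuckFunctional.

(** * Radicality for the bipartite graph *)

Lemma sum_bool_count (P : pred st) s : \sum_(x <- s) (P x : nat) = count P s.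
Proof. by elim: s => [|x s IH]; rewrite ?big_nil // big_cons IH. Qed.

Lemma locally_opposite_free s (x x' : st) :
  let P j c a := 0 < cnt j c a s in
  opposite x x' -> locally P x && locally P x' -> free (cell x) s.
Proof.
move=> P [cx xx'] /andP[/locallyP h /locallyP h']; apply/existsP; exists x.
apply/andP; split; apply/supportedP => j oj; first exact: h.
by rewrite -cx -xx' //; exact: h'.
Qed.

(* Monomials with a free parity are separated by their margins. For the others
   one sets to zero the variables of the states that are not locally compatible
   with the monomial; this kills the moves exchanging the hubs, and the finer
   degree recording all counts remains. *)
Lemma bipartite_radical (k : fieldType) : is_radical (global_ideal e d k).
Proof.
have mcI := global_ideal_congruence e d k.
apply: global_ideal_radical => s.
have [/existsP fs|/existsPn nf] := boolP [exists c, free c s].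
  exists ({set 'I_N} * st)%type, predT,
    (fun (x : st) (i : {set 'I_N} * st) => clique e i.1 && agree i.1 i.2 x : nat); split.
  - by apply/allP.
  - move=> x1 x2 x3 x4 q; split => // _ [W x0] /=.
    case cW: (clique e W) => //=.
    by have := quad_margins q x0 cW; rewrite /= !addn0.
  - move=> t _ h; apply: (mc_same_margins mcI); last by right.
    by move=> W x0 cW; have := h (W, x0); rewrite /= !sum_bool_count cW.
(* The full state in the index only supplies a value at [j], whose type depends on [j]. *)
exists ('I_N * (bool * bool) * st)%type, (locally (fun j c a => 0 < cnt j c a s)),
  (fun (x : st) (i : 'I_N * (bool * bool) * st) =>
    [&& outer i.1.1, cell x == i.1.2 & x i.1.1 == i.2 i.1.1] : nat).
split.
- apply/allP => x xs; apply/locallyP => j oj; rewrite -has_count; apply/hasP.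
  by exists x; rewrite ?eqxx.
- move=> x1 x2 x3 x4 /(@quad_locally (fun j c a => 0 < cnt j c a s)) [|[h ->]|[-> ->]] //.
    by move=> x x' xx'; apply/negP => /(locally_opposite_free xx'); apply/negP.
  split => // _ [[j c] y] /=; case oj: (outer j) => //=.
  by have := h j c (y j) oj; rewrite !cnt_cons !addn0.
- move=> t _ h; apply: (mc_same_cnt mcI) => j c a oj.
  have [ad|?] := ltnP a (d j); last by rewrite !cnt_large.
  have := h (j, c, setcoord j a (mkstate (fun=> 0))).
  rewrite /= !sum_bool_count oj /= => hc.
  have cE r : cnt j c a r = count (fun x => (cell x == c) &&
      (x j == setcoord j a (mkstate (fun=> 0)) j)) r.
    by apply: eq_count => x; rewrite -val_eqE /= setcoordE // eqxx.
  by rewrite !cE.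
Qed.

End Bipartite.

(** * Relative interior of the marginal cone *)

Section RelativeInterior.
Import numFieldNormedType.Exports.
Local Open Scope ring_scope.
Local Open Scope classical_set_scope.
Variables (V : finType) (e : rel V) (d : V -> nat) (R : realType).
Local Notation A := (map_mx intr (margin_mx e d) : 'M[R]_(_, _)).
Local Notation cone := (@marginal_cone V e d R).

(** Moving from [y] away from a column stays in the affine hull, hence in the cone for small
    steps. *)
Lemma relative_interior_column (y : 'cV[R]_#|margin_index e d|) (x : state d) :
  relative_interior cone y ->
  exists2 eps : R, 0 < eps & cone (y - eps *: col (enum_rank x) A).
Proof.
case=> ycone yint; pose a : 'cV[R]_#|margin_index e d| := col (enum_rank x) A.
have acone : cone a.
  exists (delta_mx (enum_rank x) 0); split; last by rewrite -colE.
  by move=> j; rewrite mxE; case: andP.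
have cone0 : cone 0.
  by exists 0; split; [move=> j; rewrite mxE | rewrite mulmx0].
(* As the cone contains 0, the coefficients 1, [- eps], [eps] at [y], [a], 0 give an affine
   combination. *)
have aff eps : affine_hull cone (y - eps *: a).
  exists 3, (fun i : 'I_3 => nth 0 [:: 1; - eps; eps] i),
    (fun i : 'I_3 => nth 0 [:: y; a; 0] i); split.
  - by move=> [[|[|[|]]]].
  - by rewrite !big_ord_recl big_ord0 /= addr0 addNr addr0.
  - by rewrite !big_ord_recl big_ord0 /= scale1r scaleNr scaler0 !addr0.
have lim : (fun eps : R => y - eps *: a) eps @[eps --> 0^'+] --> y.
  suff : (fun eps : R => y - eps *: a) eps @[eps --> 0^'+] --> y - 0 *: a.
    by rewrite scale0r subr0.
  apply: cvg_at_right_filter.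
  by apply: cvgB; [exact: cvg_cst | apply: cvgZr_tmp; exact: cvg_id].
have : \forall eps \near (0 : R)^'+, cone (y - eps *: a).
  apply: (@filterS _ _ _ (fun eps : R => affine_hull cone (y - eps *: a) ->
    cone (y - eps *: a))) (lim _ yint) => eps; apply; exact: aff.
move=> near_cone; near (0 : R)^'+ => eps; exists eps; first by [].
by near: eps.
Unshelve. all: by end_near.
Qed.

(** The functional vanishes at the margins of [s], so moving away from the column of [x] gives it
    the value [- eps * f x], which must be nonnegative on the cone. *)
Lemma relative_interior_margin_function (s : seq (state d)) (f : state d -> R) :
  relative_interior cone (map_mx intr (margins e (vecs s))) ->
  margin_function e f -> (forall x, 0 <= f x) -> {in s, forall x, f x = 0} ->
  forall x, f x = 0.
Proof.
move=> int [l hl] f0 fs x; apply/eqP; rewrite eq_le f0 andbT.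
have [eps eps_gt0 [c [c0 hc]]] := relative_interior_column x int.
have lA (w : 'cV[R]_#|state d|) : (l *m (A *m w)) 0 0 = \sum_j f (enum_val j) * w j 0.
  by rewrite mulmxA mxE; apply: eq_bigr => j _; rewrite hl enum_valK.
have := congr1 (fun w => (l *m w) 0 0) hc.
rewrite lA mulmxBr -scalemxAr colE => hl0.
have lu : (l *m map_mx intr (margins e (vecs s))) 0 0 = 0 :> R.
  rewrite /margins map_mxM lA big1 // => j _; rewrite !mxE.
  have [/fs->|] := boolP (enum_val j \in s); first by rewrite mul0r.
  by rewrite -has_pred1 has_count -leqNgt leqn0 => /eqP->; rewrite mulr0.
have : 0 <= \sum_j f (enum_val j) * c j 0 by apply: sumr_ge0 => j _; apply: mulr_ge0.
have lx : (l *m (A *m (delta_mx (enum_rank x) 0 : 'cV[R]_#|state d|))) 0 0 = f x.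
  by rewrite mulmxA -colE mxE hl.
have subE (M M' : 'M[R]_1) : (M - eps *: M') 0 0 = M 0 0 - eps * M' 0 0 by rewrite !mxE.
by rewrite -hl0 subE lu lx sub0r oppr_ge0 pmulr_rle0.
Qed.

End RelativeInterior.

(** * The three assertions *)

Lemma fiber_connected_by_lists (V : finType) (e : rel V) (d : V -> nat)
    (u : 'cV[nat]_#|state d|) :
  (forall s t, margins e (vecs s) = margins e u -> margins e (vecs t) = margins e u ->
     vec_connected e s t) -> fiber_connected e u.
Proof.
move=> h v w; have [s ->] := vecs_surj v; have [t ->] := vecs_surj w; exact: h.
Qed.

Theorem theorem4p6 (R : realType) (N : nat) (d : 'I_N -> nat)
    (hN : (4 <= N)%N)
    (hd : forall v : 'I_N, (2 <= d v)%N)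
    (hd2 : forall v : 'I_N, (v < 2)%N -> d v = 2) :
  [/\ interior_point_property (complete_bipartite2 N) d R,
      positive_margins_property (complete_bipartite2 N) d <-> N = 4
    & forall k : fieldType, is_radical (global_ideal (complete_bipartite2 N) d k)].
Proof.
have d_gt0 v : (0 < d v)%N by exact: ltnW.
have mc := vec_connected_congruence (complete_bipartite2 N) d.
split; last exact: bipartite_radical.
- move=> u uint; apply: fiber_connected_by_lists => s t su tu.
  have m : same_margins (complete_bipartite2 N) s t.
    by apply/(same_marginsP _ d_gt0); rewrite su tu.
  apply: (mc_same_margins (hN := hN) hd hd2 mc m); right; apply/existsP.
  (* Without a free class, [stuck_functional] would give a nonzero nonnegative functional vanishing
     at a relative interior point. *)
  apply: contraT => /existsPn nf.
  have [f [mf f0 fs [x /eqP[]]]] := stuck_functional hd hd2 R nf.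
  by apply: (relative_interior_margin_function _ mf f0 fs); rewrite su.
- split=> [pos | N4 u upos].
    apply/eqP; rewrite eqn_leq hN andbT leqNgt; apply/negP => N5.
    have u_pos i : (0 <
        margins (complete_bipartite2 N) (vecs (witness hN hd N5 false)) i 0)%R.
      rewrite -[i]enum_valK.
      have [W [cW [x0 ->]]] := margin_indexP d_gt0 (enum_val i).
      by rewrite margins_index_of; exact: witness_positive.
    apply: (@witness_disconnected N d hN hd hd2 N5).
    apply: (pos _ u_pos); first by [].
    by apply/(same_marginsP _ d_gt0); exact: witness_margins.
  apply: fiber_connected_by_lists => s t su tu.
  apply: (mc_positive_margins hN hd hd2 mc N4).
    move=> W x0 cW; have := upos (enum_rank (index_of cW x0)).
    by rewrite -su margins_index_of.
  by apply/(same_marginsP _ d_gt0); rewrite su tu.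
Qed.
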